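(* Let $n \geq 4$ and $2 \leq k \leq n-2$. Then $$R_{n-k}(C(S^{n-1}))_{+} \setminus \overline{R_{n-k}(C_{+}(S^{n-1})) + I \circ R_k (C_{+}(S^{n-1}))} \neq \emptyset.$$ In other words, there exists an (infinitely smooth) function $f \in R_{n-k}(C(S^{n-1}))_{+}$ which cannot be approximated in $C(G(n,n-k))$ by functions of the form $R_{n-k}(g) + I \circ R_k(h)$ with $g,h \in C_{+}(S^{n-1})$.
   Context: $G(n,m)$ is the Grassmann manifold of $m$-dimensional linear subspaces of $\mathbb{R}^n$. For $f\in C(S^{n-1})$ and $E\in G(n,m)$, $R_m(f)(E)=\int_{S^{n-1}\cap E} f\,d\sigma_E$, where $\sigma_E$ is the Haar (rotation-invariant) probability measure on $S^{n-1}\cap E$; so $R_m:C(S^{n-1})\to C(G(n,m))$. $I:C(G(n,k))\to C(G(n,n-k))$ is defined by $I(f)(E)=f(E^\perp)$. $C_+(S^{n-1})$ is the cone of non-negative continuous functions on $S^{n-1}$, and $R_{n-k}(C(S^{n-1}))_+$ is the cone of non-negative functions in the image $R_{n-k}(C(S^{n-1}))$. The bar denotes closure in $C(G(n,n-k))$ with the maximum norm, and the sum of two sets of functions is the set of all sums of their elements. *)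

(* Defs.v *)
From HB Require Import structures.
From mathcomp Require Import all_boot all_order all_algebra.
From mathcomp Require Import sesquilinear.
From mathcomp Require Import all_classical all_reals all_analysis.

Set Implicit Arguments.
Unset Strict Implicit.
Unset Printing Implicit Defensive.

Import Order.TTheory GRing.Theory Num.Theory.
Import numFieldNormedType.Exports.

Local Open Scope classical_set_scope.
Local Open Scope ring_scope.

(* The library norm of 'rV[R]_n is the maximum norm, so the Euclidean
   structure has to be introduced through the dot product. *)
Definition dot (R : realType) (n : nat) (u v : 'rV[R]_n) : R :=
  \sum_(i < n) u 0 i * v 0 i.

Section dot_product.
Variables (R : realType) (n : nat).

Let dot_is_bilinear : bilinear_for
  (GRing.Scale.Law.clone _ _ *%R _) (GRing.Scale.Law.clone _ _ (idfun \; *%R) _)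
  (@dot R n).
Proof.
split=> [v|u] a x y /=; rewrite /dot mulr_sumr -big_split /=;
  apply: eq_bigr => i _; rewrite !mxE.
- by rewrite mulrDl mulrA.
- by rewrite mulrDr mulrCA.
Qed.

HB.instance Definition _ :=
  bilinear_isBilinear.Build R _ _ _ _ _ (@dot R n) dot_is_bilinear.

Let dot_is_symmetric (u v : 'rV[R]_n) :
  dot u v = (-1) ^+ false * idfun (dot v u).
Proof. by rewrite expr0 mul1r; apply: eq_bigr => i _; rewrite mulrC. Qed.

HB.instance Definition _ :=
  isHermitianSesquilinear.Build R _ false idfun (@dot R n) dot_is_symmetric.

Lemma dot_gt0 (u : 'rV[R]_n) : u != 0 -> 0 < dot u u.
Proof.
rewrite /dot => u0; rewrite lt_def sumr_ge0 ?andbT; last first.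
  by move=> i _; rewrite -expr2 sqr_ge0.
apply: contra u0; rewrite psumr_eq0 => [/allP h|i _]; last first.
  by rewrite -expr2 sqr_ge0.
apply/eqP/rowP => i; rewrite mxE; have /h := mem_index_enum i.
by rewrite mulf_eq0 orbb => /eqP.
Qed.

HB.instance Definition _ := isDotProduct.Build R _ (@dot R n) dot_gt0.

End dot_product.

Definition sphere (R : realType) (n : nat) : set 'rV[R]_n :=
  [set x | dot x x = 1].
Arguments sphere {R} n _.

Notation perp E := (orthov (@dot _ _) E).

Section orthogonal_complement.
Variables (R : realType) (n : nat).
Implicit Types E : {vspace 'rV[R]_n}.

Lemma cap_perp E : (E :&: perp E)%VS = 0%VS.
Proof.
apply/eqP; rewrite -subv0; apply/subvP => u; rewrite memv_cap memv0.
move=> /andP[uE /mem_orthovP /(_ u uE) uu]; apply/negPn/negP => u0.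
by have := dot_gt0 u0; rewrite uu ltxx.
Qed.

Let dim_bigcap_lker (I : Type) (r : seq I) (f : I -> 'Hom('rV[R]_n, R^o)) :
  (n <= \dim (\bigcap_(i <- r) lker (f i))%VS + size r)%N.
Proof.
elim: r => [|i r ih] /=; first by rewrite big_nil dimvf /dim /= mul1n addn0.
rewrite big_cons addnS -addSn (leq_trans ih)// leq_add2r.
set V := (\bigcap_(j <- r) _)%VS.
have le1 : (\dim (f i @: V) <= 1)%N.
  by rewrite (leq_trans (dimvS (subvf _)))// dimvf.
rewrite -(limg_ker_dim (f i) V) capvC.
by rewrite (leq_trans (leq_add (leqnn _) le1))// addn1.
Qed.

Lemma dim_perp E : \dim (perp E) = (n - \dim E)%N.
Proof.
have le1 : (\dim E + \dim (perp E) <= n)%N.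
  rewrite -dimv_disjoint_sum ?cap_perp// (leq_trans (dimvS (subvf _)))//.
  by rewrite dimvf /dim /= mul1n.
have le2 : (n <= \dim (perp E) + \dim E)%N.
  have sz : size (index_enum 'I_(\dim E)) = \dim E.
    by rewrite -[RHS]card_ord cardT enumT.
  by rewrite -[X in (_ + X)%N]sz; exact: dim_bigcap_lker.
apply/eqP; rewrite eqn_leq leq_subLR [(\dim E + _)%N]addnC le2 andbT.
by rewrite leq_subRL ?(leq_trans (leq_addr _ _) le1).
Qed.

End orthogonal_complement.

(* The Grassmann manifold G(n, m) *)
Record grassmann (R : realType) (n m : nat) := Grassmann {
  gr_space :> {vspace 'rV[R]_n};
  _ : \dim gr_space == m }.

HB.instance Definition _ R n m := [isSub for @gr_space R n m].
HB.instance Definition _ R n m := [Choice of grassmann R n m by <:].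

(* The matrix of the orthogonal projection onto E; it induces the usual
   topology of the Grassmann manifold. *)
Definition orthoproj_mx (R : realType) (n m : nat) (E : grassmann R n m) :
  'M[R]_n := lin1_mx (daddv_pi E (perp E)).

HB.instance Definition _ (R : realType) (n m : nat) :=
  Topological.copy (grassmann R n m) (initial_topology (@orthoproj_mx R n m)).

Fact perp_subproof (R : realType) (n k : nat) (hk : (k <= n)%N)
  (E : grassmann R n (n - k)) : \dim (perp E) == k.
Proof. by case: E => E /= /eqP dE; rewrite dim_perp dE subKn. Qed.

Definition gr_perp (R : realType) (n k : nat) (hk : (k <= n)%N)
  (E : grassmann R n (n - k)) : grassmann R n k :=
  Grassmann (perp_subproof hk E).

Definition borel_rV (R : realType) (n : nat) :=
  g_sigma_algebraType (@open 'rV[R]_n).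

(* The orthogonal transformations of E are the restrictions to E of the
   orthogonal transformations of R^n that preserve E. *)
Definition haar_sphere (R : realType) (n : nat) (E : {vspace 'rV[R]_n})
    (mu : probability (borel_rV R n) R) : Prop :=
  mu (sphere n `&` [set` E]) = 1%E /\
  forall Q : 'M[R]_n, Q *m Q^T = 1%:M ->
    (forall x, x \in E -> x *m Q \in E) ->
    forall A : set (borel_rV R n), measurable A ->
      mu ((fun x : 'rV[R]_n => x *m Q) @^-1` A) = mu A.

(* sigma_E: for E != 0 there is exactly one measure satisfying [haar_sphere E],
   so that neither the choice made by [xget] nor its default value matters. *)
Definition sphere_measure (R : realType) (n : nat) (E : {vspace 'rV[R]_n}) :
    probability (borel_rV R n) R :=
  xget (dirac ((0 : 'rV[R]_n) : borel_rV R n) : probability (borel_rV R n) R)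
       (@haar_sphere R n E).

Definition contS (R : realType) (n : nat) : set ('rV[R]_n -> R) :=
  [set f | {within sphere n, continuous f}].
Arguments contS {R} n _.

Definition contS_ge0 (R : realType) (n : nat) : set ('rV[R]_n -> R) :=
  [set f | contS n f /\ forall x, sphere n x -> 0 <= f x].
Arguments contS_ge0 {R} n _.

(* R_m *)
Definition radon (R : realType) (n m : nat) (f : 'rV[R]_n -> R)
    (E : grassmann R n m) : R :=
  \int[sphere_measure E]_(x in sphere n `&` [set` gr_space E]) f x.

(* I *)
Definition comp_perp (R : realType) (n k : nat) (hk : (k <= n)%N)
    (F : grassmann R n k -> R) : grassmann R n (n - k) -> R :=
  fun E => F (gr_perp hk E).

(* Closure in C(G(n, m)) for the maximum norm. *)
Definition closureCG (R : realType) (n m : nat)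
    (B : set (grassmann R n m -> R)) : set (grassmann R n m -> R) :=
  [set F | continuous F /\ closure (B : set {uniform grassmann R n m -> R}) F].

Definition radon_image_ge0 (R : realType) (n m : nat) :
    set (grassmann R n m -> R) :=
  [set F | (@radon R n m @` contS n) F /\ forall E, 0 <= F E].
Arguments radon_image_ge0 {R} n m _.

(* R_{n-k}(C_+(S^{n-1})) + I o R_k (C_+(S^{n-1})) *)
Definition radon_cone (R : realType) (n k : nat) (hk : (k <= n)%N) :
    set (grassmann R n (n - k) -> R) :=
  [set F \+ G | F in @radon R n (n - k) @` contS_ge0 n
              & G in (comp_perp hk \o @radon R n k) @` contS_ge0 n].

(* f is infinitely differentiable on the open set U: all iterated directional
   derivatives exist and are continuous on U. *)
Definition smooth_on (R : realType) (V : normedModType R) (U : set V)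
    (f : V -> R) : Prop :=
  forall (s : seq V) (x : V), U x ->
    let g := foldr (fun v (h : V -> R^o) y => 'D_v h y) f s in
    {for x, continuous g} /\ forall v, derivable g x v.

Definition row_span (R : realType) (n m : nat) (A : 'M[R]_(m, n)) :
    {vspace 'rV[R]_n} :=
  <<[seq row i A | i <- enum 'I_m]>>%VS.

Definition frame_pullback (R : realType) (n m : nat)
    (F : grassmann R n m -> R) (A : 'M[R]_(m, n)) : R :=
  oapp F 0 (insub (row_span A)).

(* The span map from the m-frames of R^n (an open subset of the m x n matrices)
   to G(n, m) is a surjective submersion, and a function on G(n, m) is smooth
   exactly when its pullback to the space of frames is. *)
Definition smoothG (R : realType) (n m : nat) (F : grassmann R n m -> R) : Prop :=
  smooth_on [set A : 'M[R]_(m, n) | row_free A] (frame_pullback F).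

Lemma leq_of_bounds (n k : nat) : (2 <= k <= n - 2)%N -> (k <= n)%N.
Proof. by move=> /andP[_ /leq_trans]; apply; exact: leq_subr. Qed.

(* Main.v *)
From HB Require Import structures.
Require Import Defs.
From mathcomp Require Import all_boot all_order all_algebra.
From mathcomp Require Import sesquilinear.
From mathcomp Require Import all_classical all_reals all_analysis.
From mathcomp Require Import measurable_realfun.
From mathcomp Require Import ring lra.

(** Fix a unit vector [e] and write [c(E)], [sqlen e E] below, for the squared
    length of the orthogonal projection of [e] to [E].

    Rotation invariance determines the moments of the measure of the sphere of
    [E]: the mean of [<x, e> ^ 2j] is [c(E) ^ j] up to a positive constant that
    depends only on [j] and on the dimension ([haar_moment]).  Hence every
    polynomial in [c] is the Radon transform of an even polynomial in [<x, e>]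
    ([radon_radon_primitive]); it is smooth, because [c] is a rational function
    of the entries of a frame of [E] ([smoothG_poly_sqlen]).  The functions of
    the theorem are the bumps [(1 - (c - 1/2)^2)^N], which are nonnegative.

    They are separated from the cone by the functional that averages a function
    of [E] against the weight [(c(E) - 1/2)^2 - eta], where [E] is uniformly
    distributed, that is, [E] is a fixed subspace [E0] rotated by a random
    orthogonal matrix [M^T].

    - The functional is nonnegative on Radon transforms of nonnegative functions
      [g] ([average_radonv_ge0]).  By Fubini it suffices to average
      [g (x M^T)] against the weight for each fixed unit vector [x] of [E0].
      The vector [e M], conditionally on the point [x M^T], is isotropic in the
      orthogonal complement of [x], a space of dimension [n - 1].  The number
      [1 - c] is the squared length of its projection to the orthogonal
      complement of [E0], which is a proper subspace of this complement since
      [E0] has dimension at least two.  Second and fourth moments show that such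
      a squared length has a positive variance, conditionally on the length of
      the isotropic vector: the conditional mean of [(c - 1/2)^2] is at least
      some [eta > 0] ([sqproj_spread]).  Exchanging [E0] and its complement, and
      [c] and [1 - c], gives the same conclusion for the second summand of the
      cone, as [k] is also at least two.
    - The functional is negative on the bumps for [N] large, since [c] is close
      to [1/2] with positive probability and the bump concentrates there
      ([bump_average_lt0]).

    The measures involved are constructed as follows.  Lebesgue measure on [R^n]
    is built by induction on [n] as a product; its rotation invariance comes from
    a factorization of reflections into shears, to which Fubini applies.  Its
    radial projections to the subspaces [E] give the invariant measures on
    spheres ([haar_sphere_exists]), which are unique by Christensen's argument
    ([haar_sphere_unique]).  The invariant measure on the orthogonal group is
    obtained from those on spheres, again by induction ([haar_orth_exists]). *)

Set Implicit Arguments.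
Unset Strict Implicit.
Unset Printing Implicit Defensive.

Import Order.TTheory GRing.Theory Num.Theory.
Import numFieldNormedType.Exports.

Local Open Scope classical_set_scope.
Local Open Scope ring_scope.

(** * Euclidean geometry of row vectors *)

Section euclid.
Variables (R : realType) (n : nat).
Implicit Types (x y u v w : 'rV[R]_n) (Q : 'M[R]_n) (a : R).
Implicit Types E U V : {vspace 'rV[R]_n}.

Lemma dotE x y : dot x y = (x *m y^T) 0 0.
Proof. by rewrite mxE; apply: eq_bigr => i _; rewrite mxE. Qed.

Lemma dotC x y : dot x y = dot y x.
Proof. by apply: eq_bigr => i _; rewrite mulrC. Qed.

Lemma dotDl x y z : dot (x + y) z = dot x z + dot y z.
Proof. by rewrite !dotE mulmxDl mxE. Qed.

Lemma dotZl a x y : dot (a *: x) y = a * dot x y.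
Proof. by rewrite !dotE -scalemxAl mxE. Qed.

Lemma dotNl x y : dot (- x) y = - dot x y.
Proof. by rewrite -scaleN1r dotZl mulN1r. Qed.

Lemma dotBl x y z : dot (x - y) z = dot x z - dot y z.
Proof. by rewrite dotDl dotNl. Qed.

Lemma dotDr x y z : dot z (x + y) = dot z x + dot z y.
Proof. by rewrite dotC dotDl !(dotC z). Qed.

Lemma dotZr a x y : dot y (a *: x) = a * dot y x.
Proof. by rewrite dotC dotZl dotC. Qed.

Lemma dotNr x y : dot y (- x) = - dot y x.
Proof. by rewrite dotC dotNl dotC. Qed.

Lemma dotBr x y z : dot z (x - y) = dot z x - dot z y.
Proof. by rewrite dotDr dotNr. Qed.

Lemma dot0l x : dot 0 x = 0.
Proof. by rewrite -(scale0r 0) dotZl mul0r. Qed.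

Lemma dot0r x : dot x 0 = 0.
Proof. by rewrite dotC dot0l. Qed.

Lemma dot_ge0 x : 0 <= dot x x.
Proof. by apply: sumr_ge0 => i _; rewrite -expr2 sqr_ge0. Qed.

Lemma dot_eq0 x : (dot x x == 0) = (x == 0).
Proof.
apply/idP/idP => [|/eqP ->]; last by rewrite dot0l.
by apply: contraLR => /dot_gt0; rewrite lt0r => /andP[].
Qed.

Lemma dot_sqrD x y : dot (x + y) (x + y) = dot x x + 2 * dot x y + dot y y.
Proof. by rewrite !(dotDl, dotDr) (dotC y x); ring. Qed.

Lemma dot_sqrB x y : dot (x - y) (x - y) = dot x x - 2 * dot x y + dot y y.
Proof. by rewrite dot_sqrD dotNr dotNl dotNr; ring. Qed.

Lemma dot_mulmx x y (A : 'M[R]_n) : dot (x *m A) y = dot x (y *m A^T).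
Proof. by rewrite !dotE trmx_mul trmxK mulmxA. Qed.

Lemma dot_orth Q x y : Q *m Q^T = 1%:M -> dot (x *m Q) (y *m Q) = dot x y.
Proof. by move=> QQ; rewrite dot_mulmx -mulmxA QQ mulmx1. Qed.

Lemma orth_tr Q : Q *m Q^T = 1%:M -> Q^T *m Q^T^T = 1%:M.
Proof. by rewrite trmxK => /mulmx1C. Qed.

Lemma orthM Q Q' : Q *m Q^T = 1%:M -> Q' *m Q'^T = 1%:M ->
  (Q *m Q') *m (Q *m Q')^T = 1%:M.
Proof.
by move=> QQ QQ'; rewrite trmx_mul mulmxA -(mulmxA Q) QQ' mulmx1.
Qed.

Definition basis_vec (i : 'I_n) : 'rV[R]_n := delta_mx 0 i.

Lemma dot_basis x i : dot x (basis_vec i) = x 0 i.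
Proof.
rewrite /dot (bigD1 i)//= big1 ?addr0 => [|j ji]; rewrite !mxE eqxx.
  by rewrite eqxx mulr1.
by rewrite (negbTE ji) mulr0.
Qed.

Lemma dot_parseval x y :
  \sum_i dot x (basis_vec i) * dot y (basis_vec i) = dot x y.
Proof. by apply: eq_bigr => i _; rewrite !dot_basis. Qed.

(** The Householder reflection in the hyperplane orthogonal to [u].  It is the
    identity for [u = 0], because [0^-1 = 0]; this makes [refl_swap] hold
    without any side condition. *)
Definition refl u : 'M[R]_n := 1%:M - (2 / dot u u) *: (u^T *m u).

Lemma mul_refl x u : x *m refl u = x - (2 * dot x u / dot u u) *: u.
Proof.
rewrite /refl mulmxBr mulmx1 -scalemxAr mulmxA; congr (_ - _).
rewrite [x *m u^T]mx11_scalar -dotE mul_scalar_mx scalerA.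
by congr (_ *: _); rewrite mulrAC.
Qed.

Lemma refl_tr u : (refl u)^T = refl u.
Proof. by rewrite /refl linearB linearZ /= trmx1 trmx_mul trmxK. Qed.

Lemma reflK x u : x *m refl u *m refl u = x.
Proof.
have [->|u0] := eqVneq u 0; first by rewrite !mul_refl !scaler0 !subr0.
have d0 : dot u u != 0 by rewrite dot_eq0.
rewrite !mul_refl dotBl dotZl -addrA -opprD -scalerDl.
rewrite [X in X *: _](_ : _ = 0) ?scale0r ?subr0//.
by field.
Qed.

Lemma refl_orth u : refl u *m (refl u)^T = 1%:M.
Proof.
by apply/row_matrixP => i; rewrite refl_tr -{1}[refl u]mul1mx !row_mul reflK.
Qed.

Lemma refl_swap x y : dot x x = dot y y -> x *m refl (x - y) = y.
Proof.
move=> xy; have [/subr0_eq ->|u0] := eqVneq (x - y) 0.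
  by rewrite subrr mul_refl scaler0 subr0.
have d0 : dot (x - y) (x - y) != 0 by rewrite dot_eq0.
rewrite mul_refl [X in X *: _](_ : _ = 1) ?scale1r ?subKr//.
apply: (mulIf d0); rewrite mul1r divfK//.
by rewrite !(dotBl, dotBr) xy (dotC y x); ring.
Qed.

Lemma refl_fix x u : dot x u = 0 -> x *m refl u = x.
Proof. by move=> xu; rewrite mul_refl xu mulr0 mul0r scale0r subr0. Qed.

Lemma refl_stable E u x : u \in E -> x \in E -> x *m refl u \in E.
Proof. by move=> uE xE; rewrite mul_refl rpredB// rpredZ. Qed.

Lemma mem_perpP E x : reflect (forall w, w \in E -> dot x w = 0) (x \in perp E).
Proof. exact: (iffP mem_orthovP). Qed.

Definition proj E x : 'rV[R]_n := daddv_pi E (perp E) x.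

Fact proj_is_linear E : linear (proj E).
Proof. by move=> a x y; rewrite /proj linearP. Qed.

HB.instance Definition _ E :=
  GRing.isLinear.Build R _ _ _ (proj E) (proj_is_linear E).

Lemma memv_eproj E x : proj E x \in E. Proof. exact: memv_pi. Qed.

Lemma addv_perp E : (E + perp E)%VS = fullv.
Proof.
apply/eqP; rewrite eqEdim subvf /= dimv_disjoint_sum ?cap_perp// dim_perp.
have := dimvS (subvf E); rewrite dimvf /dim /= mul1n => h.
by rewrite subnKC.
Qed.

Lemma sub_proj_perp E x : x - proj E x \in perp E.
Proof.
rewrite -{1}(@daddv_pi_add _ _ E (perp E) x) ?cap_perp ?addv_perp ?memvf//.
by rewrite addrC addKr memv_pi.
Qed.

Lemma proj_id E x : x \in E -> proj E x = x.
Proof. by move=> xE; rewrite /proj daddv_pi_id ?cap_perp. Qed.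

Lemma dot_proj E x w : w \in E -> dot (proj E x) w = dot x w.
Proof.
move=> wE; apply/eqP; rewrite eq_sym -subr_eq0 -dotBl; apply/eqP.
by move/mem_perpP : (sub_proj_perp E x); apply.
Qed.

Lemma projP E x y : y \in E -> (forall w, w \in E -> dot x w = dot y w) ->
  proj E x = y.
Proof.
move=> yE h; apply/eqP; rewrite -subr_eq0 -memv0 -(cap_perp E) memv_cap.
rewrite rpredB ?memv_eproj//=; apply/mem_perpP => w wE.
by rewrite dotBl dot_proj// h// subrr.
Qed.

Lemma dot_proj_sym E x y : dot (proj E x) y = dot x (proj E y).
Proof.
rewrite -(dot_proj x (memv_eproj E y)) dotC [RHS]dotC.
by rewrite dot_proj ?memv_eproj.
Qed.

Lemma dot_projK E x : dot (proj E x) x = dot (proj E x) (proj E x).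
Proof. by rewrite dotC -[LHS](dot_proj _ (memv_eproj E x)). Qed.

Lemma dot_proj_le E x : dot (proj E x) (proj E x) <= dot x x.
Proof.
rewrite -subr_ge0; have := dot_ge0 (x - proj E x).
by rewrite dotBl !dotBr dot_projK (dotC x) dot_projK; lra.
Qed.

Lemma dot_projD E x :
  dot (proj E x) (proj E x) + dot (proj (perp E) x) (proj (perp E) x) = dot x x.
Proof.
have -> : proj (perp E) x = x - proj E x.
  apply: projP; first exact: sub_proj_perp.
  move=> w /mem_perpP wE; rewrite dotBl (dotC (proj E x)) wE ?subr0//.
  exact: memv_eproj.
by rewrite dotBl !dotBr dot_projK (dotC x) dot_projK; ring.
Qed.

Lemma perpK E : perp (perp E) = E.
Proof.
apply/esym/eqP; rewrite eqEdim !dim_perp leq_subLR addnC -leq_subLR leqnn andbT.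
apply/subvP => x xE; apply/mem_perpP => w /mem_perpP wE.
by rewrite dotC wE.
Qed.

(** Although the [proj E (basis_vec i)] are not a basis of [E], they satisfy
    Parseval's identity in [E]; this replaces orthonormal bases of subspaces. *)
Lemma sum_dot_proj_basis E x y :
  \sum_i dot x (proj E (basis_vec i)) * dot y (proj E (basis_vec i)) =
  dot (proj E x) (proj E y).
Proof.
under eq_bigr do rewrite -!dot_proj_sym.
exact: dot_parseval.
Qed.

(** This sum is the trace of the projection, computed in a basis of [E]. *)
Lemma sum_dot_proj_proj E :
  \sum_i dot (proj E (basis_vec i)) (proj E (basis_vec i)) = (\dim E)%:R.
Proof.
transitivity (\sum_(j < \dim E) \sum_i
    coord (vbasis E) j (proj E (basis_vec i)) * (vbasis E)`_j 0 i).
  rewrite [RHS]exchange_big /=; apply: eq_bigr => i _.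
  rewrite -dot_projK dot_basis {1}(coord_vbasis (memv_eproj E _)) summxE.
  by apply: eq_bigr => j _; rewrite mxE.
transitivity (\sum_(j < \dim E) (1 : R)); last by rewrite sumr_const card_ord.
apply: eq_bigr => j _.
transitivity (coord (vbasis E) j (proj E (vbasis E)`_j)).
  rewrite [X in proj E X](row_sum_delta (vbasis E)`_j) !linear_sum /=.
  by apply: eq_bigr => i _; rewrite !linearZ /= mulrC.
have jE : (vbasis E)`_j \in E by rewrite vbasis_mem ?mem_nth ?size_tuple.
by rewrite proj_id// coord_free ?eqxx ?(basis_free (vbasisP E)).
Qed.

End euclid.

(** * Borel sets of matrices *)

Section borel_mx.
Variables (R : realType) (m n : nat).

Definition borel_mx := g_sigma_algebraType (@open 'M[R]_(m, n)).

Lemma open_borel_mx (U : set 'M[R]_(m, n)) :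
  open U -> measurable (U : set borel_mx).
Proof. exact: sub_sigma_algebra. Qed.

Lemma measurable_fun_continuous_mx (g : 'M[R]_(m, n) -> R) :
  continuous g -> measurable_fun setT (g : borel_mx -> R).
Proof.
move=> /continuousP cg; apply: (measurability _ (RGenOpens.measurableE R)).
move=> _ [_ [a [b ->] <-]]; rewrite setTI; apply: open_borel_mx.
by apply: cg; exact: interval_open.
Qed.

Lemma continuous_entry i j : continuous (fun A : 'M[R]_(m, n) => A i j).
Proof. exact: coord_continuous. Qed.

Lemma measurable_entry i j :
  measurable_fun setT ((fun A : 'M[R]_(m, n) => A i j) : borel_mx -> R).
Proof. by apply: measurable_fun_continuous_mx; exact: continuous_entry. Qed.

Lemma rat_approx_mx (A : 'M[R]_(m, n)) (e : R) : 0 < e ->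
  exists q : 'M[rat]_(m, n), forall i j, `|A i j - ratr (q i j)| < e.
Proof.
move=> e0; have hq i j : exists q : rat, `|A i j - ratr q| < e.
  have : A i j - e < A i j + e by rewrite ltrBlDr -addrA ltrDl addr_gt0.
  move=> /rat_in_itvoo[q]; rewrite in_itv/= => /andP[q1 q2]; exists q.
  by rewrite ltr_distlC q1 q2.
exists (\matrix_(i, j) xchoose (hq i j)) => i j.
by rewrite mxE; exact: (xchooseP (hq i j)).
Qed.

(** Boxes with rational centres and radii [1 / (k + 1)] form a countable basis
    of the topology of matrices, so that measurability can be tested on the
    entries. *)
Lemma measurable_fun_mx d (T : measurableType d) (f : T -> 'M[R]_(m, n)) :
  (forall i j, measurable_fun setT (fun t => f t i j)) ->
  measurable_fun setT (f : T -> borel_mx).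
Proof.
move=> mf; apply: (measurability (@open 'M[R]_(m, n) : set (set borel_mx)) erefl).
move=> _ [U oU <-]; rewrite setTI.
pose c (q : 'M[rat]_(m, n)) : 'M[R]_(m, n) := map_mx ratr q.
pose B (p : 'M[rat]_(m, n) * nat) : set 'M[R]_(m, n) := ball (c p.1) p.2.+1%:R^-1.
have -> : U = \bigcup_(p in [set p | B p `<=` U]) B p.
  apply/seteqP; split => [A UA|A [p /= pU pA]]; last exact: pU.
  have /nbhs_ballP[e /= e0 eU] : nbhs A U by exact: open_nbhs_nbhs.
  have [k ke] : exists k : nat, k.+1%:R^-1 < e / 2.
    exists (Num.truncn (e / 2)^-1).
    rewrite invf_plt ?posrE ?divr_gt0 ?ltr0n//.
    exact: truncnS_gt.
  have [q qA] : exists q : 'M[rat]_(m, n),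
      forall i j, `|A i j - ratr (q i j)| < k.+1%:R^-1.
    by apply: rat_approx_mx; rewrite invr_gt0 ltr0n.
  exists (q, k).
    move=> /= C [_ qC]; apply: eU; split => // i j; rewrite /ball/=.
    have h1 := qA i j; have h2 := qC i j; rewrite /ball/= [c q i j]mxE in h2.
    have -> : A i j - C i j = (A i j - ratr (q i j)) + (ratr (q i j) - C i j).
      by rewrite addrA subrK.
    apply: (le_lt_trans (ler_normD _ _)); rewrite [e]splitr.
    by apply: ltrD; [exact: lt_trans h1 ke|exact: lt_trans h2 ke].
  split; first by rewrite invr_gt0 ltr0n.
  by move=> i j; rewrite /ball/= [c q i j]mxE distrC.
rewrite bigcup_mkcond preimage_bigcup.
apply: countable_bigcupT_measurable => [|p]; first exact: countableP.
case: ifPn => _; last by rewrite preimage_set0.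
have -> : f @^-1` B p = \bigcap_(ij in [set: 'I_m * 'I_n])
    [set t | `|c p.1 ij.1 ij.2 - f t ij.1 ij.2| < p.2.+1%:R^-1].
  apply/seteqP; split => [t [_ h] [i j] _|t h]; first exact: h.
  split; first by rewrite invr_gt0 ltr0n.
  by move=> i j; exact: (h (i, j)).
apply: fin_bigcap_measurable => // -[i j] _ /=.
have mg : measurable_fun setT (fun t => `|c p.1 i j - f t i j|).
  by apply: measurableT_comp => //; exact: measurable_funB.
have := mg measurableT `]-oo, p.2.+1%:R^-1[%classic (measurable_itv _).
by rewrite setTI.
Qed.

End borel_mx.

(** * Measure preserving maps *)

Section preserves.
Context d (T : measurableType d) (R : realType).
Implicit Types (mu : set T -> \bar R) (f g : T -> T).

Definition preserves mu f := forall A, measurable A -> mu (f @^-1` A) = mu A.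

Lemma preserves_comp mu f g : measurable_fun setT g ->
  preserves mu f -> preserves mu g -> preserves mu (g \o f).
Proof.
move=> mg pf pg A mA; rewrite comp_preimage pf ?pg//.
by rewrite -[X in measurable X]setTI; exact: mg.
Qed.

End preserves.

Section preserves_product.
Context d1 d2 (T1 : measurableType d1) (T2 : measurableType d2) (R : realType).
Variables (m1 : {sigma_finite_measure set T1 -> \bar R}).
Variables (m2 : {sigma_finite_measure set T2 -> \bar R}).

Lemma preserves_snd (phi : T1 -> T2 -> T2) :
  (forall x, preserves m2 (phi x)) ->
  preserves (m1 \x m2)%E (fun p => (p.1, phi p.1 p.2)).
Proof.
move=> hphi A mA; rewrite /product_measure1; apply: eq_integral => x _ /=.
rewrite -(hphi x (xsection A x)); last exact: measurable_xsection.
by rewrite !xsectionE.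
Qed.

Lemma preserves_fst (phi : T2 -> T1 -> T1) :
  measurable_fun setT (fun p : T1 * T2 => (phi p.2 p.1, p.2)) ->
  (forall y, preserves m1 (phi y)) ->
  preserves (m1 \x m2)%E (fun p => (phi p.2 p.1, p.2)).
Proof.
move=> mphi hphi A mA.
have E B : measurable B -> (m1 \x m2)%E B = (m1 \x^ m2)%E B.
  by apply: product_measure_unique => *; exact: product_measure2E.
rewrite !E//; last by rewrite -[X in measurable X]setTI; exact: mphi.
rewrite /product_measure2; apply: eq_integral => y _ /=.
rewrite -(hphi y (ysection A y)); last exact: measurable_ysection.
by rewrite !ysectionE.
Qed.

End preserves_product.

Lemma lebesgue_measure_shift (R : realType) (a : R) :
  preserves (@lebesgue_measure R) (fun x => x + a).
Proof.
have mf : measurable_fun setT ((fun x => x + a) : measurableTypeR R -> measurableTypeR R).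
  exact: measurable_funD.
move=> A mA.
apply/esym; apply: (@lebesgue_measure_unique R (pushforward _ _)) => // X [[b c] _ <-].
rewrite /= /pushforward.
have -> : (fun x => x + a) @^-1` `]b, c]%classic = `]b - a, c - a]%classic.
  by apply/seteqP; split => x /=; rewrite !in_itv/= ltrBlDr lerBrDr.
rewrite !lebesgue_measure_itv /= !lte_fin ltrD2r; case: ifP => // _.
by rewrite -!EFinB; congr EFin; ring.
Qed.

Lemma lebesgue_measure_opp (R : realType) :
  preserves (@lebesgue_measure R) (fun x => - x).
Proof.
have mf : measurable_fun setT ((fun x => - x) : measurableTypeR R -> measurableTypeR R).
  exact: measurableT_comp.
move=> A mA.
apply/esym; apply: (@lebesgue_measure_unique R (pushforward _ _)) => // X [[b c] _ <-].
rewrite /= /pushforward.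
have -> : (fun x => - x) @^-1` `]b, c]%classic = `[- c, - b[%classic.
  by apply/seteqP; split => x /=; rewrite !in_itv/= lerNl ltrNr andbC.
rewrite !lebesgue_measure_itv /= !lte_fin ltrN2; case: ifP => // _.
by rewrite -!EFinB; congr EFin; ring.
Qed.

(** * Lebesgue measure on row vectors *)

Section scons.
Variables (R : realType) (n : nat).
Implicit Types (t : R) (v w a b : 'rV[R]_n) (x : 'rV[R]_n.+1).

Definition vcons t v : 'rV[R]_n.+1 := row_mx (t%:M : 'M[R]_1) v.

Lemma vcons_surj x : exists t v, x = vcons t v.
Proof.
exists ((lsubmx (x : 'rV[R]_(1 + n))) 0 0), (rsubmx (x : 'rV[R]_(1 + n))).
by rewrite /vcons -mx11_scalar hsubmxK.
Qed.

Lemma vcons_head t v : vcons t v 0 ord0 = t.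
Proof.
rewrite mxE; case: splitP => [j _|j] //.
by rewrite mxE (ord1 j) eqxx mulr1n.
Qed.

Lemma vcons_tail t v i : vcons t v 0 (lift ord0 i) = v 0 i.
Proof.
rewrite mxE; case: splitP => j; rewrite /= /bump/=.
  by move=> h; have := ltn_ord j; rewrite -h.
by rewrite !add1n => -[ij]; congr (v _ _); apply/val_inj.
Qed.

Lemma dot_vcons t v s w : dot (vcons t v) (vcons s w) = t * s + dot v w.
Proof.
transitivity ((row_mx (t%:M : 'M[R]_1) v *m
  (row_mx (s%:M : 'M[R]_1) w)^T) 0 0); first exact: dotE.
rewrite tr_row_mx mul_row_col mxE; congr (_ + _); last exact/esym/dotE.
by rewrite tr_scalar_mx -scalar_mxM mxE eqxx.
Qed.

Lemma vconsD t v s w : vcons t v + vcons s w = vcons (t + s) (v + w).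
Proof.
by apply/rowP => i; rewrite !mxE; case: splitP => j _; rewrite !mxE ?mulrnDl.
Qed.

Lemma vconsB t v s w : vcons t v - vcons s w = vcons (t - s) (v - w).
Proof.
by apply/rowP => i; rewrite !mxE; case: splitP => j _; rewrite !mxE ?mulrnBl.
Qed.

Lemma vconsZ (a : R) t v : a *: vcons t v = vcons (a * t) (a *: v).
Proof.
by apply/rowP => i; rewrite !mxE; case: splitP => j _; rewrite !mxE ?mulrnAr.
Qed.

Definition e_0 : 'rV[R]_n.+1 := vcons 1 0.

Lemma dot_e_0 : dot e_0 e_0 = 1.
Proof. by rewrite dot_vcons dot0l addr0 mulr1. Qed.

Definition lift_orth (Q : 'M[R]_n) : 'M[R]_n.+1 :=
  block_mx (1%:M : 'M[R]_1) 0 0 Q.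

Lemma vcons_lift_orth t v Q : vcons t v *m lift_orth Q = vcons t (v *m Q).
Proof.
rewrite /vcons [LHS](_ : _ = row_mx (t%:M : 'M[R]_1) v *m
  block_mx (1%:M : 'M[R]_1) 0 0 Q)//.
by rewrite mul_row_block !mulmx0 mulmx1 addr0 add0r.
Qed.

Lemma lift_orth_tr Q : (lift_orth Q)^T = lift_orth Q^T.
Proof.
have := tr_block_mx (1%:M : 'M[R]_1) 0 0 Q.
by rewrite !trmx0 trmx1; apply.
Qed.

Lemma lift_orthM Q Q' : lift_orth (Q *m Q') = lift_orth Q *m lift_orth Q'.
Proof.
have := mulmx_block (1%:M : 'M[R]_1) 0 0 Q (1%:M : 'M[R]_1) 0 0 Q'.
by rewrite !mulmx0 !mul0mx mulmx1 !addr0 !add0r => ->.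
Qed.

Lemma lift_orth1 : lift_orth 1%:M = 1%:M.
Proof. exact/esym/(scalar_mx_block 1 n). Qed.

(** The first row of [K] is [e_0]; so is its first column, because [K^T] also
    fixes [e_0]. *)
Lemma orth_fix_e_0 (K : 'M[R]_n.+1) : K *m K^T = 1%:M -> e_0 *m K = e_0 ->
  exists2 Q : 'M[R]_n, Q *m Q^T = 1%:M & K = lift_orth Q.
Proof.
move=> KK eK.
have eKT : e_0 *m K^T = e_0 by rewrite -{1}eK -mulmxA KK mulmx1.
pose A : 'M[R]_(1 + n) := K.
have AE : A = block_mx (ulsubmx A) (ursubmx A) (dlsubmx A) (drsubmx A).
  by rewrite submxK.
have ATE : A^T = block_mx (ulsubmx A)^T (dlsubmx A)^T (ursubmx A)^T (drsubmx A)^T.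
  by rewrite {1}AE tr_block_mx.
have e : row_mx (1%:M : 'M[R]_1) (0 : 'rV[R]_n) *m A = row_mx 1%:M 0 := eK.
have eT : row_mx (1%:M : 'M[R]_1) (0 : 'rV[R]_n) *m A^T = row_mx 1%:M 0 := eKT.
move: e; rewrite {1}AE mul_row_block !mul0mx !mul1mx !addr0 => /eq_row_mx[ul ur].
move: eT; rewrite ATE mul_row_block !mul0mx !mul1mx !addr0 => /eq_row_mx[_ dl].
have dl0 : dlsubmx A = 0 by rewrite -[LHS]trmxK dl trmx0.
have KE : K = lift_orth (drsubmx A).
  by transitivity A => //; rewrite {1}AE ul ur dl0.
exists (drsubmx A) => //.
move: KK; rewrite KE lift_orth_tr -lift_orthM -lift_orth1.
by rewrite /lift_orth => h; have [] := @eq_block_mx R 1 n 1 n _ _ _ _ _ _ _ _ h.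
Qed.

End scons.

Section lebesgue_rV.
Variable R : realType.

Definition cube n (N : R) : set 'rV[R]_n := [set x | forall i, `|x 0 i| <= N].

Lemma measurable_cube n N : measurable (cube N : set (borel_rV R n)).
Proof.
have -> : cube N = \bigcap_(i in [set: 'I_n]) [set x : 'rV[R]_n | `|x 0 i| <= N].
  by apply/seteqP; split => [x h i _|x h i]; exact: h.
apply: fin_bigcap_measurable => // i _.
have mg : measurable_fun setT ((fun x : 'rV[R]_n => `|x 0 i|) : borel_rV R n -> R).
  by apply: measurableT_comp => //; exact: measurable_entry.
by have := mg measurableT `]-oo, N]%classic (measurable_itv _); rewrite setTI.
Qed.

(** The properties of Lebesgue measure on [R^n] from which rotation invariant
    measures on spheres are built.  The construction is by induction on [n], and
    translation invariance in dimension [n] is what rotation invariance in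
    dimension [n + 1] rests on. *)
Definition lebesgue_like n (mu : {measure set (borel_rV R n) -> \bar R}) :=
  [/\ forall N : R, (mu (cube N) < +oo)%E, mu setT != 0%E,
      forall w : 'rV[R]_n, preserves mu (fun x => x + w) &
      forall Q : 'M[R]_n, Q *m Q^T = 1%:M -> preserves mu (fun x => x *m Q)].

Lemma lebesgue_like_sigma_finite n (mu : {measure set (borel_rV R n) -> \bar R}) :
  lebesgue_like mu -> sigma_finite setT mu.
Proof.
move=> [fin _ _ _]; exists (fun k : nat => cube k%:R).
  apply/seteqP; split => // x _.
  exists (Num.truncn (\sum_i `|x 0 i|)).+1 => // i.
  apply: le_trans (ltW (truncnS_gt _)).
  by rewrite (bigD1 i)//= lerDl sumr_ge0.
by move=> k; split; [exact: measurable_cube|exact: fin].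
Qed.

(** The same set function as [mu]; being indexed by a proof of
    [lebesgue_like mu], it can be equipped with its sigma-finiteness. *)
Definition lebesgue_copy n (mu : {measure set (borel_rV R n) -> \bar R})
  (lmu : lebesgue_like mu) : set (borel_rV R n) -> \bar R := mu.

HB.instance Definition _ n mu (lmu : @lebesgue_like n mu) :=
  Measure.copy (lebesgue_copy lmu) mu.

HB.instance Definition _ n mu (lmu : @lebesgue_like n mu) :=
  Measure_isSigmaFinite.Build _ _ _ (lebesgue_copy lmu)
    (lebesgue_like_sigma_finite lmu).

Lemma measurable_vcons n :
  measurable_fun setT ((fun p => vcons p.1 p.2) :
    measurableTypeR R * borel_rV R n -> borel_rV R n.+1).
Proof.
apply: measurable_fun_mx => i j.
have -> : i = 0 by apply: ord1.
have [k ->|->] := unliftP ord0 j.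
  under eq_fun do rewrite vcons_tail.
  apply: (measurableT_comp (@measurable_entry R 1 n 0 k)).
  exact: measurable_snd.
by under eq_fun do rewrite vcons_head; exact: measurable_fst.
Qed.

Lemma measurable_addr n w :
  measurable_fun setT ((fun x => x + w) : borel_rV R n -> borel_rV R n).
Proof.
apply: measurable_fun_mx => i j; under eq_fun do rewrite mxE.
by apply: measurable_funD => //; exact: measurable_entry.
Qed.

Lemma measurable_mulmxr n p (Q : 'M[R]_(n, p)) :
  measurable_fun setT ((fun x => x *m Q) : borel_rV R n -> borel_rV R p).
Proof.
apply: measurable_fun_mx => i j; under eq_fun do rewrite mxE.
apply: measurable_sum => k.
by apply: measurable_funM => //; exact: measurable_entry.
Qed.

Lemma measurable_dot d (T : measurableType d) n (f g : T -> 'rV[R]_n) :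
  measurable_fun setT (f : T -> borel_rV R n) ->
  measurable_fun setT (g : T -> borel_rV R n) ->
  measurable_fun setT (fun t => dot (f t) (g t)).
Proof.
move=> mf mg; apply: measurable_sum => k.
by apply: measurable_funM;
  exact: (measurableT_comp (@measurable_entry R 1 n 0 k)).
Qed.

Section vcons_step.
Variables (n : nat) (mu : {sigma_finite_measure set (borel_rV R n) -> \bar R}).
Hypothesis lmu : lebesgue_like mu.

Let lam := @lebesgue_measure R.
Let T := (measurableTypeR R * borel_rV R n)%type.
Let P : set T -> \bar R := (lam \x mu)%E.

Let shear (a : 'rV[R]_n) (p : T) : T := (p.1 + dot p.2 a, p.2).
Let slide (b : 'rV[R]_n) (p : T) : T := (p.1, p.2 + p.1 *: b).
Let flip (p : T) : T := (- p.1, p.2).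

Let measurable_shear a : measurable_fun setT (shear a).
Proof.
apply: measurable_fun_pair; last exact: measurable_snd.
apply: measurable_funD; first exact: measurable_fst.
by apply: measurable_dot => //; exact: measurable_snd.
Qed.

Let measurable_flip : measurable_fun setT flip.
Proof.
apply: measurable_fun_pair; last exact: measurable_snd.
by apply: measurableT_comp => //; exact: measurable_fst.
Qed.

Let measurable_slide b : measurable_fun setT (slide b).
Proof.
apply: measurable_fun_pair; first exact: measurable_fst.
apply: measurable_fun_mx => i j; under eq_fun do rewrite !mxE.
apply: measurable_funD.
  by apply: (measurableT_comp (@measurable_entry R 1 n i j)); exact: measurable_snd.
by apply: measurable_funM => //; exact: measurable_fst.
Qed.

Let preserves_shear a : preserves P (shear a).
Proof.
apply: (@preserves_fst _ _ _ _ _ lam mu (fun y x => x + dot y a)).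
  exact: measurable_shear.
by move=> y; exact: lebesgue_measure_shift.
Qed.

Let preserves_flip : preserves P flip.
Proof.
apply: (@preserves_fst _ _ _ _ _ lam mu (fun y x => - x)).
  exact: measurable_flip.
by move=> y; exact: lebesgue_measure_opp.
Qed.

Let preserves_slide b : preserves P (slide b).
Proof.
apply: (@preserves_snd _ _ _ _ _ lam mu (fun x y => y + x *: b)) => x.
by case: lmu.
Qed.

Let nu := pushforward P (fun p => vcons p.1 p.2 : borel_rV R n.+1).

Let preserves_push (g : 'rV[R]_n.+1 -> 'rV[R]_n.+1) (h : T -> T) :
  measurable_fun setT (g : borel_rV R n.+1 -> borel_rV R n.+1) ->
  preserves P h ->
  (forall t v, g (vcons t v) = vcons (h (t, v)).1 (h (t, v)).2) ->
  preserves nu g.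
Proof.
move=> mg ph gh A mA; rewrite /nu /pushforward.
rewrite -[RHS]ph; last first.
  by rewrite -[X in measurable X]setTI; exact: measurable_vcons.
by congr (P _); apply/seteqP; split => -[t v] /=; rewrite gh.
Qed.

(** A reflection [refl u] with [u] having a nonzero first coordinate is a
    product of shears along the first coordinate, of translations of the other
    coordinates depending on the first one, and of a sign change of the first
    coordinate; each of them preserves the product measure by Fubini. *)
Let preserves_refl (u0 : R) (u' : 'rV[R]_n) : u0 != 0 ->
  preserves nu (fun x => x *m refl (vcons u0 u')).
Proof.
move=> u00; pose u := vcons u0 u'.
have uu : dot u u = u0 ^+ 2 + dot u' u' by rewrite dot_vcons.
have uu0 : u0 ^+ 2 + dot u' u' != 0.
  by rewrite gt_eqF// ltr_wpDr ?dot_ge0// exprn_even_gt0.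
pose a := u0^-1 *: u'; pose b := - (2 * u0 / dot u u) *: u'.
apply: (@preserves_push _ (shear (- a) \o (flip \o (slide b \o shear a)))).
- exact: measurable_mulmxr.
- apply: preserves_comp; [exact: measurable_shear| |exact: preserves_shear].
  apply: preserves_comp; [exact: measurable_flip| |exact: preserves_flip].
  by apply: preserves_comp; [exact: measurable_slide|exact: preserves_shear|
    exact: preserves_slide].
move=> t v /=.
rewrite mul_refl -/u vconsZ vconsB dot_vcons uu.
congr vcons.
  rewrite dotNr dotDl !dotZr !dotZl uu.
  by field; rewrite uu0 u00.
congr (_ + _); rewrite /b scalerA uu -scaleNr; congr (_ *: _).
by rewrite dotZr; field; rewrite uu0 u00.
Qed.

(** The reflection [refl (e_0 - e_0 *m Q)] brings [e_0 *m Q] back to [e_0], so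
    that [Q] is the product of a matrix fixing [e_0], for which Fubini and the
    invariance in dimension [n] suffice, and of this reflection.  If the first
    coordinate of [e_0 - e_0 *m Q] vanishes, then so does the whole vector. *)
Let preserves_orth (Q : 'M[R]_n.+1) : Q *m Q^T = 1%:M ->
  preserves nu (fun x => x *m Q).
Proof.
move=> QQ; pose e : 'rV[R]_n.+1 := e_0 R n; pose u := e - e *m Q.
have eH : e *m Q *m refl u = e.
  have eu : e *m refl u = e *m Q by apply: refl_swap; rewrite dot_orth.
  by rewrite -eu reflK.
have [K KK QE] : exists2 K : 'M[R]_n, K *m K^T = 1%:M & Q *m refl u = lift_orth K.
  by apply: orth_fix_e_0; [apply: orthM => //; exact: refl_orth|rewrite mulmxA].
have preK : preserves nu (fun x => x *m lift_orth K).
  apply: (@preserves_push _ (fun p => (p.1, p.2 *m K))).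
  - exact: measurable_mulmxr.
  - apply: (@preserves_snd _ _ _ _ _ lam mu (fun x y => y *m K)) => _.
    by case: lmu => _ _ _; exact.
  - by move=> t v; rewrite vcons_lift_orth.
have preH : preserves nu (fun x => x *m refl u).
  have [u0 [u' uE]] := vcons_surj u.
  rewrite uE; have [u00|] := eqVneq u0 0; last exact: preserves_refl.
  suff -> : vcons u0 u' = 0.
    move=> A mA; congr (nu _).
    by apply/seteqP; split => x /=; rewrite refl_fix// dot0r.
  have h : dot (e - u) (e - u) = 1.
    by rewrite subKr dot_orth// dot_e_0.
  have eu : dot e u = 0 by rewrite uE dot_vcons dot0l u00 mulr0 addr0.
  apply/eqP; rewrite -dot_eq0 -uE; apply/eqP; move: h.
  by rewrite dot_sqrB dot_e_0 eu; lra.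
have QE' (x : 'rV[R]_n.+1) : x *m Q = x *m lift_orth K *m refl u.
  by rewrite -QE mulmxA reflK.
under eq_fun do rewrite QE'.
apply: (preserves_comp _ preK preH).
exact: measurable_mulmxr.
Qed.

Lemma lebesgue_like_vcons :
  exists mu' : {measure set (borel_rV R n.+1) -> \bar R}, lebesgue_like mu'.
Proof.
have mv := @measurable_vcons n.
exists (pushforward P (fun p => vcons p.1 p.2 : borel_rV R n.+1)).
have [fin nz tr _] := lmu.
have lamT : lam setT = +oo%E by rewrite /lam -set_itvNyy lebesgue_measure_itv.
split.
- move=> N; rewrite /= /pushforward /P.
  rewrite (_ : _ @^-1` _ = `[-N, N]%classic `*` cube N); last first.
    apply/seteqP; split => [[t v] h|[t v] [/= h1 h2] i].
      split => [|i] /=; last by rewrite -(vcons_tail t); exact: h.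
      by rewrite in_itv/= -ler_norml -[X in `|X|](vcons_head t v); exact: h.
    have [j ->|->] := unliftP ord0 i; first by rewrite vcons_tail.
    by rewrite vcons_head ler_norml; move: h1; rewrite in_itv.
  rewrite product_measure1E//; last exact: measurable_cube.
  rewrite lte_mul_pinfty//; last exact: fin.
  by rewrite /= lebesgue_measure_itv; case: ifP.
- rewrite /= /pushforward /P preimage_setT -setXTT product_measure1E//.
  by rewrite /= -/lam lamT mule_eq0 negb_or nz andbT.
- move=> w; have [w0 [w' ->]] := vcons_surj w.
  apply: (@preserves_push _ ((fun p => (p.1, p.2 + w')) \o (fun p => (p.1 + w0, p.2)))).
  + exact: measurable_addr.
  + apply: preserves_comp.
    * apply: measurable_fun_pair; first exact: measurable_fst.
      by apply: (measurableT_comp (measurable_addr w')); exact: measurable_snd.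
    * apply: (@preserves_fst _ _ _ _ _ lam mu (fun y x => x + w0)).
        apply: measurable_fun_pair; last exact: measurable_snd.
        by apply: measurable_funD => //; exact: measurable_fst.
      by move=> _; exact: lebesgue_measure_shift.
    * by apply: (@preserves_snd _ _ _ _ _ lam mu (fun x y => y + w')) => _; exact: tr.
  + by move=> t v; rewrite vconsD.
- exact: preserves_orth.
Unshelve. exact: mv.
Qed.

End vcons_step.

Lemma lebesgue_like_exists n :
  exists mu : {measure set (borel_rV R n) -> \bar R}, lebesgue_like mu.
Proof.
elim: n => [|n [mu lmu]]; last first.
  exact: (@lebesgue_like_vcons n (lebesgue_copy lmu)).
have x0 (x : 'rV[R]_0) : x = 0 by apply/rowP => -[].
exists (dirac (0 : borel_rV R 0)); split.
- by move=> N /=; rewrite diracE ltry.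
- by rewrite /= diracT.
- by move=> w A mA; congr (dirac _ _); apply/seteqP; split => x /=;
    rewrite (x0 x) (x0 (_ + _)).
- by move=> Q _ A mA; congr (dirac _ _); apply/seteqP; split => x /=;
    rewrite (x0 x) (x0 (_ *m _)).
Qed.

End lebesgue_rV.

(** * Rotation invariant measures on spheres *)

Section orthogonal_image.
Variables (R : realType) (n : nat).
Implicit Types (E : {vspace 'rV[R]_n}) (Q : 'M[R]_n) (x : 'rV[R]_n).

Definition img Q E : {vspace 'rV[R]_n} := (linfun (mulmxr Q) @: E)%VS.

Lemma memv_img_mx Q E x : x \in E -> x *m Q \in img Q E.
Proof. by move=> xE; apply/memv_imgP; exists x => //; rewrite lfunE. Qed.

Lemma mem_img_mxP Q E x :
  reflect (exists2 y, y \in E & x = y *m Q) (x \in img Q E).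
Proof.
by apply: (iffP memv_imgP) => -[y yE ->]; exists y => //; rewrite lfunE.
Qed.

Lemma orth_inj Q x y : Q *m Q^T = 1%:M -> x *m Q = y *m Q -> x = y.
Proof. by move=> QQ /(congr1 (mulmx^~ Q^T)); rewrite -!mulmxA QQ !mulmx1. Qed.

Lemma dim_img Q E : Q *m Q^T = 1%:M -> \dim (img Q E) = \dim E.
Proof.
move=> QQ; apply: limg_dim_eq; apply/eqP; rewrite -subv0.
apply/subvP => x; rewrite memv_cap memv_ker lfunE /= memv0 => /andP[_ /eqP xQ].
by apply/eqP; apply: (orth_inj QQ); rewrite xQ mul0mx.
Qed.

Lemma img_stable Q E : Q *m Q^T = 1%:M ->
  (forall x, x \in E -> x *m Q \in E) -> img Q E = E.
Proof.
move=> QQ QE; apply/eqP; rewrite eqEdim dim_img// leqnn andbT.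
by apply/subvP => x /mem_img_mxP[y yE ->]; exact: QE.
Qed.

Lemma proj_img Q E x : Q *m Q^T = 1%:M ->
  proj (img Q E) (x *m Q) = proj E x *m Q.
Proof.
move=> QQ; apply: projP; first by apply: memv_img_mx; exact: memv_eproj.
by move=> _ /mem_img_mxP[w wE ->]; rewrite !dot_orth// dot_proj.
Qed.

Lemma perp_img Q E : Q *m Q^T = 1%:M -> perp (img Q E) = img Q (perp E).
Proof.
move=> QQ; apply/esym/eqP; rewrite eqEdim dim_img// !dim_perp dim_img// leqnn.
rewrite andbT; apply/subvP => _ /mem_img_mxP[y /mem_perpP yE ->].
by apply/mem_perpP => _ /mem_img_mxP[w wE ->]; rewrite dot_orth// yE.
Qed.

End orthogonal_image.

Section push.
Context d1 d2 (T1 : measurableType d1) (T2 : measurableType d2) (R : realType).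
Variables (f : T1 -> T2) (mf : measurable_fun setT f).

Definition push (mu : set T1 -> \bar R) of measurable_fun setT f :
  set T2 -> \bar R := pushforward mu f.

HB.instance Definition _ (mu : {measure set T1 -> \bar R}) :=
  Measure.copy (push mu mf)
    (measure_function_pushforward__canonical__measure_function_Measure mu mf).

Let push_setT (P : probability T1 R) : push P mf setT = 1%E.
Proof. by rewrite /push /pushforward preimage_setT probability_setT. Qed.

HB.instance Definition _ (P : probability T1 R) :=
  Measure_isProbability.Build _ _ _ (push P mf) (push_setT P).

End push.

Section borel_geometry.
Variables (R : realType) (n : nat).
Implicit Types (E : {vspace 'rV[R]_n}) (Q : 'M[R]_n) (x : 'rV[R]_n).

Lemma measurable_proj E :
  measurable_fun setT (proj E : borel_rV R n -> borel_rV R n).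
Proof.
have -> : proj E = (fun x => x *m lin1_mx (proj E)).
  by apply: funext => x; rewrite mul_rV_lin1.
exact: measurable_mulmxr.
Qed.

Lemma measurable_le_cst d (T : measurableType d) (f : T -> R) (a : R) :
  measurable_fun setT f -> measurable [set t | f t <= a].
Proof.
move=> mf; have := mf measurableT `]-oo, a]%classic (measurable_itv _).
by rewrite setTI.
Qed.

Lemma measurable_eq_cst d (T : measurableType d) (f : T -> R) (a : R) :
  measurable_fun setT f -> measurable [set t | f t = a].
Proof.
by move=> mf; have := mf measurableT [set a] (measurable_set1 _); rewrite setTI.
Qed.

Lemma measurable_sphere : measurable (sphere n : set (borel_rV R n)).
Proof. by apply: measurable_eq_cst; apply: measurable_dot. Qed.

Lemma measurable_vspace E : measurable ([set` E] : set (borel_rV R n)).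
Proof.
rewrite (_ : [set` E] =
    [set x | dot (x - proj E x) (x - proj E x) = 0]); last first.
  apply/seteqP; split => x /= => [xE|/eqP].
    by rewrite proj_id// subrr dot0l.
  by rewrite dot_eq0 subr_eq0 => /eqP ->; exact: memv_eproj.
have m : measurable_fun setT ((fun x => x - proj E x) : borel_rV R n -> borel_rV R n).
  apply: measurable_fun_mx => i j; under eq_fun do rewrite !mxE.
  apply: measurable_funB; first exact: measurable_entry.
  apply: (measurableT_comp (@measurable_entry R 1 n i j)).
  exact: measurable_proj.
by apply: measurable_eq_cst; exact: measurable_dot.
Qed.

Lemma measurable_sphereI E :
  measurable (sphere n `&` [set` E] : set (borel_rV R n)).
Proof.
by apply: measurableI; [exact: measurable_sphere|exact: measurable_vspace].
Qed.

End borel_geometry.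

Lemma measurable_inv (R : realType) : measurable_fun setT (@GRing.inv R).
Proof.
rewrite -(setvU [set (0 : R)]) setUC; apply/measurable_funU => //.
  exact: measurableC.
split; first exact: measurable_fun_set1.
apply: open_continuous_measurable_fun.
  by apply: closed_openC; exact: closed_eq.
by move=> x /[!inE]/= /eqP x0; exact: inv_continuous.
Qed.

Section haar_existence.
Variables (R : realType) (n : nat) (E : {vspace 'rV[R]_n}).
Hypothesis E0 : (0 < \dim E)%N.

(** The orthogonal projection to [E], rescaled to length one.  Its value is [0]
    where the projection vanishes. *)
Definition radial (x : 'rV[R]_n) : 'rV[R]_n :=
  (Num.sqrt (dot (proj E x) (proj E x)))^-1 *: proj E x.

Lemma measurable_radial :
  measurable_fun setT (radial : borel_rV R n -> borel_rV R n).
Proof.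
apply: measurable_fun_mx => i j; under eq_fun do rewrite mxE.
apply: measurable_funM; last first.
  apply: (measurableT_comp (@measurable_entry R 1 n i j)).
  exact: measurable_proj.
apply: measurableT_comp; first exact: measurable_inv.
apply: measurableT_comp.
  by apply: continuous_measurable_fun; exact: sqrt_continuous.
by apply: measurable_dot; exact: measurable_proj.
Qed.

Lemma radial_sphere x : dot (proj E x) (proj E x) != 0 ->
  (sphere n `&` [set` E]) (radial x).
Proof.
move=> d0; have dp : 0 < dot (proj E x) (proj E x) by rewrite lt_def d0 dot_ge0.
split; last by rewrite /= rpredZ// memv_eproj.
rewrite /sphere /= /radial dotZl dotZr mulrA -expr2 exprVn sqr_sqrtr ?ltW//.
by rewrite mulVf.
Qed.

(** The image of Lebesgue measure by the radial projection, after restriction to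
    a ball, to make it finite, and to the vectors with a nonzero projection.  All
    these operations commute with the orthogonal matrices preserving [E]. *)
Lemma haar_sphere_exists :
  exists mu : probability (borel_rV R n) R, haar_sphere E mu.
Proof.
have [L lL] := lebesgue_like_exists R n.
have [fin nz tr orth] := lL.
pose Z : set (borel_rV R n) := [set x | dot (proj E x) (proj E x) = 0].
have mZ : measurable Z.
  by apply: measurable_eq_cst; apply: measurable_dot; exact: measurable_proj.
pose B (k : nat) : set (borel_rV R n) := [set x | dot x x <= k%:R ^+ 2].
have mB k : measurable (B k) by apply: measurable_le_cst; apply: measurable_dot.
pose D k := B k `&` ~` Z.
have mD k : measurable (D k) by apply: measurableI => //; exact: measurableC.
have Dfin k : (L (D k) < +oo)%E.
  apply: le_lt_trans (fin k%:R); apply: le_measure; rewrite ?inE//.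
    exact: measurable_cube.
  move=> x [Bx _] i; rewrite -(@ler_pXn2r _ 2) ?nnegrE// real_normK ?num_real//.
  apply: le_trans Bx; rewrite /dot (bigD1 i)//= -expr2 lerDl.
  by apply: sumr_ge0 => j _; rewrite -expr2 sqr_ge0.
have [k Dk] : exists k, L (D k) != 0%E.
  apply/not_existsP => h; move: nz.
  have nZ : L (~` Z) = 0%E.
    have -> : ~` Z = \bigcup_k D k.
      apply/seteqP; split => [x Zx|x [k _ []]//].
      exists (Num.truncn (dot x x)).+1 => //; split => //.
      rewrite /B /= (le_trans (ltW (truncnS_gt _)))//.
      by rewrite -natrX ler_nat expnS expn1 leq_pmulr.
    apply/eqP; rewrite -measure_le0.
    apply: le_trans (measure_sigma_subadditive _ mD _ _) _ => //.
      exact: bigcup_measurable.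
    rewrite eseries0// => i _ _.
    by have /negP := h i; rewrite negbK => /eqP.
  have [u uE u0] : exists2 u, u \in E & u != 0.
    by exists (vpick E); [exact: memv_pick|rewrite vpick0 -dimv_eq0 -lt0n].
  (* [Z] and its translate by [u] are disjoint, so their complements cover *)
  have nZ' : L ((fun x => x + u) @^-1` (~` Z)) = 0%E.
    by rewrite tr//; exact: measurableC.
  apply/negP; rewrite negbK -measure_le0.
  have -> : [set: borel_rV R n] = ~` Z `|` (fun x => x + u) @^-1` (~` Z).
    apply/seteqP; split => // x _; have [Zx|] := pselect (Z x); last by left.
    right => /= /eqP; move/eqP : Zx; rewrite !dot_eq0 linearD /= => /eqP ->.
    by rewrite add0r proj_id//; exact/negP.
  have mu' : measurable ((fun x : 'rV[R]_n => x + u) @^-1` (~` Z) : set (borel_rV R n)).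
    by rewrite -[X in measurable X]setTI; apply: measurable_addr => //; exact: measurableC.
  apply: le_trans (measureU2 _ _ _) _ => //; first exact: measurableC.
  set a := (X in (X + _)%E); set b := (X in (_ + X)%E).
  by rewrite (nZ : a = 0%E) (nZ' : b = 0%E) adde0.
pose nu : {measure set (borel_rV R n) -> \bar R} :=
  push (mrestr L (mD k)) measurable_radial.
have nuE A : nu A = L (radial @^-1` A `&` D k) by [].
pose P : probability (borel_rV R n) R :=
  mnormalize nu (dirac (0 : borel_rV R n)).
have nuT : nu setT = L (D k) by rewrite nuE preimage_setT setTI.
have PE A : P A = (nu A * (fine (L (D k)))^-1%:E)%E.
  by rewrite /P /= /mnormalize nuT (negbTE Dk) (lt_eqF (Dfin k)).
exists P; split.
  rewrite PE (_ : nu _ = L (D k)); last first.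
    rewrite nuE; congr (L _); apply/seteqP; split => [x []//|x Dx].
    by split => //; apply: radial_sphere; apply/eqP; case: Dx.
  rewrite -{1}(@fineK _ (L (D k))); last first.
    by rewrite ge0_fin_numE//; exact: Dfin.
  by rewrite -EFinM divff// fine_eq0// ge0_fin_numE//; exact: Dfin.
move=> Q QQ QE A mA; rewrite !PE; congr (_ * _)%E; rewrite !nuE.
have projQ x : proj E (x *m Q) = proj E x *m Q.
  by rewrite -{1}(img_stable QQ QE) proj_img.
have radQ x : radial (x *m Q) = radial x *m Q.
  by rewrite /radial projQ dot_orth// scalemxAl.
rewrite -[RHS](orth Q QQ); last first.
  apply: measurableI => //; rewrite -[X in measurable X]setTI.
  exact: measurable_radial.
by congr (L _); apply/seteqP; split => x /=;
  rewrite /D /B /Z /= radQ projQ !dot_orth.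
Qed.

Lemma sphere_measureP : haar_sphere E (sphere_measure E).
Proof. by apply: xgetPex; exact: haar_sphere_exists. Qed.

End haar_existence.

(** * Uniqueness of the rotation invariant measure *)

Lemma probability_full d (T : measurableType d) (R : realType)
    (P : probability T R) (A D : set T) :
  measurable A -> measurable D -> P D = 1%E -> P (A `&` D) = P A.
Proof.
move=> mA mD PD; have nD : P (~` D) = 0%E by rewrite probability_setC// PD subee.
apply/eqP; rewrite eq_le; apply/andP; split.
  by apply: le_measure; rewrite ?inE//; exact: measurableI.
rewrite -{1}(setIT A) -(setUv D) setIUr.
apply: le_trans (measureU2 _ _ _) _; [exact: measurableI| |].
  by apply: measurableI => //; exact: measurableC.
rewrite geeDl// -nD; apply: le_measure; rewrite ?inE//.
- by apply: measurableI => //; exact: measurableC.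
- exact: measurableC.
Qed.

Lemma continuous_sumr (T : topologicalType) (R : realType) (I : Type)
    (s : seq I) (f : I -> T -> R) :
  (forall i, continuous (f i)) -> continuous (fun x => \sum_(i <- s) f i x).
Proof.
move=> cf; elim: s => [|i s IH].
  by under eq_fun do rewrite big_nil; exact: cst_continuous.
under eq_fun do rewrite big_cons.
by move=> x; apply: cvgD; [exact: cf|exact: IH].
Qed.

Section dball.
Variables (R : realType) (n : nat).
Implicit Types (x y : 'rV[R]_n) (r : R).

(** The Euclidean ball of radius [sqrt r], which is invariant under rotations,
    unlike the balls of the maximum norm. *)
Definition dball y r : set 'rV[R]_n := [set x | dot (x - y) (x - y) < r].

Lemma dballC x y r : dball y r x -> dball x r y.
Proof. by rewrite /dball /= -opprB dotNl dotNr opprK. Qed.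

Lemma continuous_dot (f g : 'rV[R]_n -> 'rV[R]_n) :
  continuous f -> continuous g -> continuous (fun x => dot (f x) (g x)).
Proof.
move=> cf cg; apply: continuous_sumr => i x.
have c (h : 'rV[R]_n -> 'rV[R]_n) : continuous h ->
    (fun x : 'rV[R]_n => h x 0 i) @ x --> h x 0 i.
  move=> ch; exact: (continuous_comp (ch x) (@continuous_entry R 1 n 0 i (h x))).
exact: (cvgM (c f cf) (c g cg)).
Qed.

Lemma open_dball y r : open (dball y r).
Proof.
have /continuousP c : continuous (fun x => dot (x - y) (x - y)).
  have c : continuous (fun x => x - y) 
    by move=> x; exact: (cvgB cvg_id (cvg_cst y)).
  exact: (continuous_dot c c).
have -> : dball y r = (fun x => dot (x - y) (x - y)) @^-1` [set t | t < r] by [].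
by apply: c; exact: open_lt.
Qed.

Lemma measurable_dball y r : measurable (dball y r : set (borel_rV R n)).
Proof. by apply: open_borel_mx; exact: open_dball. Qed.

Lemma measurable_dball_prod r :
  measurable ([set p | dball p.2 r p.1] : set (borel_rV R n * borel_rV R n)).
Proof.
have mB : measurable_fun setT (fun p : borel_rV R n * borel_rV R n =>
    (p.1 : 'rV[R]_n) - (p.2 : 'rV[R]_n) : borel_rV R n).
  apply: measurable_fun_mx => i j; under eq_fun do rewrite !mxE.
  apply: measurable_funB; apply: (measurableT_comp (@measurable_entry R 1 n i j)).
    exact: measurable_fst.
  exact: measurable_snd.
have := measurable_dot mB mB => /(_ measurableT `]-oo, r[%classic (measurable_itv _)).
by rewrite setTI.
Qed.

Lemma sub_dball_ball y (e : R) : 0 < e -> dball y (e ^+ 2) `<=` ball y e.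
Proof.
move=> e0 x; rewrite /dball /= => xy; split => // i j.
rewrite /ball /= distrC -(@ltr_pXn2r _ 2) ?nnegrE ?normr_ge0 ?ltW//.
rewrite real_normK ?num_real//; apply: le_lt_trans xy.
rewrite /dot (bigD1 j)//= (ord1 i) !mxE -expr2 lerDl.
by apply: sumr_ge0 => k _; rewrite -expr2 sqr_ge0.
Qed.

(** If the balls of radius [sqrt r] around the points of a set are null, then
    such a cover shows that the set is null. *)
Lemma small_cover r : 0 < r -> exists C : nat -> set (borel_rV R n),
  [/\ forall k, measurable (C k),
      forall k x y, C k x -> C k y -> dball y r x & \bigcup_k C k = setT].
Proof.
move=> r0; pose c : R := 4 * n%:R + 1.
have c0 : 0 < c by rewrite ltr_wpDl// mulr_ge0.
pose e := Num.min 1 (r / c).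
have e0 : 0 < e by rewrite lt_min ltr01 divr_gt0.
pose C k : set (borel_rV R n) := if (unpickle k : option 'rV[rat]_n) is Some q then
  ball (map_mx ratr q : 'rV[R]_n) e else set0.
exists C; split.
- move=> k; rewrite /C; case: unpickle => [q|]; last exact: measurable0.
  by apply: open_borel_mx; exact: ball_open.
- move=> k x y; rewrite /C; case: unpickle => // q [_ qx] [_ qy].
  rewrite /dball /= /dot.
  (* coordinates differ by at most [2 * e], and [(2 * e) ^+ 2 <= 4 * e] *)
  apply: (@le_lt_trans _ _ (\sum_(i < n) 4 * e)).
    apply: ler_sum => i _; rewrite !mxE -expr2.
    have {}qx := qx 0 i; have {}qy := qy 0 i.
    have e1 : e <= 1 by rewrite ge_min lexx.
    set t : R := map_mx ratr q 0 i in qx qy *.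
    have h : `|x 0 i - y 0 i| <= 2 * e.
      have -> : x 0 i - y 0 i = (t - y 0 i) - (t - x 0 i) by ring.
      rewrite (le_trans (ler_normB _ _))// mulr2n mulrDl mul1r.
      by rewrite lerD// ltW.
    rewrite -real_normK ?num_real//.
    apply: (@le_trans _ _ ((2 * e) ^+ 2)).
      by rewrite ler_pXn2r ?nnegrE ?mulr_ge0// ltW.
    by nra.
  rewrite sumr_const card_ord -[_ *+ n]mulr_natl mulrA mulrC.
  apply: (@le_lt_trans _ _ ((r / c) * (n%:R * 4))).
    by rewrite ler_wpM2r ?mulr_ge0// ge_min lexx orbT.
  rewrite mulrAC ltr_pdivrMr// ltr_pM2l// /c mulrC ltrDl//.
- apply/seteqP; split => // x _.
  have [q xq] := rat_approx_mx x e0.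
  exists (pickle q) => //; rewrite /C pickleK; split => // i j.
  by rewrite /ball /= mxE distrC.
Qed.

End dball.

Section haar_measures.
Variables (R : realType) (n : nat) (E : {vspace 'rV[R]_n}).
Implicit Types mu nu : probability (borel_rV R n) R.

Let X : set (borel_rV R n) := sphere n `&` [set` E].

Let mX : measurable X. Proof. exact: measurable_sphereI. Qed.

Lemma haar_sphereI mu (A : set (borel_rV R n)) : haar_sphere E mu ->
  measurable A -> mu (A `&` X) = mu A.
Proof.
by move=> [mu1 _] mA; exact: probability_full.
Qed.

(** The reflection exchanging two points of the sphere of [E] preserves [E] and
    exchanges the balls around these points. *)
Lemma haar_dball mu x y r : haar_sphere E mu -> X x -> X y ->
  mu (dball x r) = mu (dball y r).
Proof.
move=> [_ inv] [xs xE] [ys yE].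
have xy : x *m refl (x - y) = y.
  by apply: refl_swap; rewrite [LHS]xs [RHS]ys.
rewrite -[RHS](inv (refl (x - y)) (refl_orth _) _ (dball y r)); first last.
- exact: measurable_dball.
- by move=> z zE; apply: refl_stable => //; rewrite rpredB.
have : refl (x - y) *m (refl (x - y))^T = 1%:M by exact: refl_orth.
move: (refl _) xy => Q <- QQ; congr (mu _).
by apply/seteqP; split => z; rewrite /dball /= -mulmxBl dot_orth.
Qed.

Lemma haar_dball_gt0 mu x r : haar_sphere E mu -> X x -> 0 < r ->
  (0 < mu (dball x r))%E.
Proof.
move=> hmu Xx r0; rewrite lt0e measure_ge0 andbT; apply/eqP => mu0.
have [C [mC dC CT]] := small_cover n r0.
suff : mu setT = 0%E by rewrite probability_setT => /eqP; rewrite onee_eq0.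
rewrite -(haar_sphereI hmu measurableT) -CT setI_bigcupl.
apply/eqP; rewrite -measure_le0.
have mCX k : measurable (C k `&` X) by exact: measurableI.
apply: le_trans (measure_sigma_subadditive _ mCX _ _) _ => //.
  exact: bigcup_measurable.
rewrite eseries0// => k _ _ /=; apply/eqP; rewrite -measure_le0.
have [->|/set0P[y [Cy Xy]]] := eqVneq (C k `&` X) set0; first by rewrite measure0.
rewrite -mu0 (haar_dball r hmu Xx Xy); apply: le_measure; rewrite ?inE//.
  exact: measurable_dball.
by move=> z [Cz _]; exact: dC Cz Cy.
Qed.

Lemma haar_sphere_neq0 mu : haar_sphere E mu -> X !=set0.
Proof.
move=> [mu1 _]; apply/set0P/eqP => X0; move: mu1.
by rewrite -/X X0 measure0 => /esym/eqP; rewrite onee_eq0.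
Qed.

Let pairs (A B : set (borel_rV R n)) r : set (borel_rV R n * borel_rV R n) :=
  ((A `&` X) `*` (B `&` X)) `&` [set p | dball p.2 r p.1].

Let measurable_pairs A B r : measurable A -> measurable B ->
  measurable (pairs A B r).
Proof.
move=> mA mB; apply: measurableI; last exact: measurable_dball_prod.
by apply: measurableX; exact: measurableI.
Qed.

Let product_pairs1 mu nu A x r : haar_sphere E mu -> haar_sphere E nu ->
  measurable A -> X x -> (mu \x nu)%E (pairs A setT r) = (mu A * nu (dball x r))%E.
Proof.
move=> hmu hnu mA Xx; rewrite /product_measure1.
rewrite (eq_integral (fun y => (nu (dball x r) * (\1_(A `&` X) y)%:E)%E)).
  rewrite ge0_integralZl//; last first.
    by apply/measurable_EFinP; apply: measurable_indic; exact: measurableI.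
  rewrite integral_indic//; last exact: measurableI.
  by rewrite setIT muleC; congr (_ * _)%E; exact: haar_sphereI.
move=> y _ /=; rewrite indicE; have [yA|yA] := boolP (y \in A `&` X).
  rewrite mule1; move: yA => /[!inE] -[Ay Xy].
  rewrite (haar_dball r hnu Xx Xy) -[RHS](haar_sphereI hnu); last first.
    exact: measurable_dball.
  congr (nu _); apply/seteqP; split => z; rewrite xsectionE /pairs /=.
    by move=> [[_ [_ Xz]] /dballC].
  by move=> [/dballC].
rewrite mule0 (_ : xsection _ _ = set0) ?measure0//.
apply/seteqP; split => z //; rewrite xsectionE /pairs /= => -[[Ay _] _].
by move: yA; rewrite notin_setE; apply.
Qed.

Let product_pairs2 mu nu B x r : haar_sphere E mu -> haar_sphere E nu ->
  measurable B -> X x -> (mu \x nu)%E (pairs setT B r) = (nu B * mu (dball x r))%E.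
Proof.
move=> hmu hnu mB Xx.
have -> : (mu \x nu)%E (pairs setT B r) = (mu \x^ nu)%E (pairs setT B r).
  apply: product_measure_unique; last exact: measurable_pairs.
  by move=> *; exact: product_measure2E.
rewrite /product_measure2.
rewrite (eq_integral (fun y => (mu (dball x r) * (\1_(B `&` X) y)%:E)%E)).
  rewrite ge0_integralZl//; last first.
    by apply/measurable_EFinP; apply: measurable_indic; exact: measurableI.
  rewrite integral_indic//; last exact: measurableI.
  by rewrite setIT muleC; congr (_ * _)%E; exact: haar_sphereI.
move=> y _ /=; rewrite indicE; have [yB|yB] := boolP (y \in B `&` X).
  rewrite mule1; move: yB => /[!inE] -[By Xy].
  rewrite (haar_dball r hmu Xx Xy) -[RHS](haar_sphereI hmu); last first.
    exact: measurable_dball.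
  congr (mu _); apply/seteqP; split => z; rewrite ysectionE /pairs /=.
    by move=> [[[_ Xz] _] h].
  by move=> [h Xz].
rewrite mule0 (_ : ysection _ _ = set0) ?measure0//.
apply/seteqP; split => z //; rewrite ysectionE /pairs /= => -[[_ By] _].
by move: yB; rewrite notin_setE; apply.
Qed.

(** Christensen's argument: if [V] consists of points at distance at least
    [sqrt r] from the complement of [U], then the pairs of points at distance
    less than [sqrt r] with the first point in [V] have their second one in
    [U], and the measures of these sets of pairs are the measures of [V] and
    [U] times that of a ball of radius [sqrt r], by Fubini. *)
Let haar_le_open mu nu (U : set 'rV[R]_n) : haar_sphere E mu -> haar_sphere E nu ->
  open U -> (mu U <= nu U)%E.
Proof.
move=> hmu hnu oU.
have mU : measurable (U : set (borel_rV R n)) by exact: open_borel_mx.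
pose r (k : nat) : R := k.+1%:R^-1.
have r0 k : 0 < r k by rewrite invr_gt0.
pose V k : set (borel_rV R n) := ~` \bigcup_(y in ~` U) dball y (r k).
have mV k : measurable (V k).
  apply: measurableC; apply: open_borel_mx; apply: bigcup_open => y _.
  exact: open_dball.
have VU : \bigcup_k V k = U.
  apply/seteqP; split => [x [k _ Vx]|x Ux].
    apply: contrapT => nUx; apply: Vx; exists x => //.
    by rewrite /dball /= subrr dot0l.
  have /nbhs_ballP[e /= e0 eU] : nbhs x U by exact: open_nbhs_nbhs.
  exists (Num.truncn (e ^+ 2)^-1) => // -[y nUy] /dballC xy; apply: nUy.
  apply: eU; apply: (sub_dball_ball e0); rewrite /dball /=.
  apply: lt_le_trans xy _; rewrite /r invf_ple ?posrE ?exprn_gt0//.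
  exact/ltW/truncnS_gt.
have [x Xx] := haar_sphere_neq0 hmu.
have h A k : measurable A -> A `<=` V k -> (mu A <= nu U)%E.
  move=> mA AV.
  have eqk : nu (dball x (r k)) = mu (dball x (r k)).
    have := product_pairs1 (r k) hmu hnu measurableT Xx.
    rewrite (product_pairs2 _ hmu hnu measurableT Xx).
    by rewrite [in LHS]probability_setT [in RHS]probability_setT !mul1e.
  have b0 : (0 < mu (dball x (r k)))%E by exact: haar_dball_gt0.
  have bfin : mu (dball x (r k)) \is a fin_num.
    by apply: fin_num_measure; exact: measurable_dball.
  rewrite -(@lee_pmul2r _ (mu (dball x (r k))))//.
  rewrite -{1}eqk -(product_pairs1 _ hmu hnu mA Xx).
  rewrite -(product_pairs2 _ hmu hnu mU Xx).
  apply: le_measure; rewrite ?inE; [exact: measurable_pairs..|].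
  move=> [y z] [[/= [Ay Xy] [_ Xz]] yz]; split => //; split => //=; split => //.
  by apply: contrapT => nUz; apply: (AV _ Ay); exists z.
have Vnd : nondecreasing_seq V.
  move=> k l kl; apply/subsetPset => z; apply: contra_not => -[y nUy yz].
  exists y => //; apply: lt_le_trans yz _.
  by rewrite /r lef_pV2 ?posrE// ler_nat.
rewrite -{1}VU; apply: cvge_le (nondecreasing_cvg_mu mV _ Vnd).
  by near=> k; apply: (h (V k) k).
by rewrite VU.
Unshelve. all: by end_near.
Qed.

Theorem haar_sphere_unique mu nu : haar_sphere E mu -> haar_sphere E nu ->
  forall A, measurable A -> mu A = nu A.
Proof.
move=> hmu hnu A mA.
apply: (measure_unique (@open 'rV[R]_n : set (set (borel_rV R n))) (fun=> setT)) => //.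
- exact: openI.
- by move=> _; exact: openT.
- by apply/seteqP; split => // x _; exists 0%N.
- by move=> U oU; apply/eqP; rewrite eq_le !haar_le_open.
- by move=> _; rewrite [ltLHS]probability_setT ltry.
Qed.

End haar_measures.

(** * Haar measure on the orthogonal group *)

Section haar_orthogonal.
Variable R : realType.

Definition orthogonal n : set 'M[R]_n := [set M | M *m M^T = 1%:M].
Arguments orthogonal : clear implicits.

Lemma measurable_fun_mulmx d (T : measurableType d) m n p
    (f : T -> 'M[R]_(m, n)) (g : T -> 'M[R]_(n, p)) :
  measurable_fun setT (f : T -> borel_mx R m n) ->
  measurable_fun setT (g : T -> borel_mx R n p) ->
  measurable_fun setT ((fun t => f t *m g t) : T -> borel_mx R m p).
Proof.
move=> mf mg; apply: measurable_fun_mx => i j; under eq_fun do rewrite mxE.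
apply: measurable_sum => k; apply: measurable_funM.
  exact: (measurableT_comp (@measurable_entry R m n i k)).
exact: (measurableT_comp (@measurable_entry R n p k j)).
Qed.

Lemma measurable_fun_tr d (T : measurableType d) m n (f : T -> 'M[R]_(m, n)) :
  measurable_fun setT (f : T -> borel_mx R m n) ->
  measurable_fun setT ((fun t => (f t)^T) : T -> borel_mx R n m).
Proof.
move=> mf; apply: measurable_fun_mx => i j; under eq_fun do rewrite mxE.
exact: (measurableT_comp (@measurable_entry R m n j i)).
Qed.

Lemma measurable_mulmx_cst m n p (Q : 'M[R]_(n, p)) :
  measurable_fun setT ((fun M => M *m Q) : borel_mx R m n -> borel_mx R m p).
Proof. by apply: measurable_fun_mulmx. Qed.

Lemma measurable_refl d (T : measurableType d) n (u : T -> 'rV[R]_n) :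
  measurable_fun setT (u : T -> borel_rV R n) ->
  measurable_fun setT ((fun t => refl (u t)) : T -> borel_mx R n n).
Proof.
move=> mu; have mu1 (i : 'I_1) j : measurable_fun setT (fun t => u t i j).
  exact: (measurableT_comp (@measurable_entry R 1 n i j)).
have md : measurable_fun setT (fun t => 2 / dot (u t) (u t)).
  apply: measurable_funM => //; apply: measurableT_comp => //.
    exact: measurable_inv.
  exact: measurable_dot.
apply: measurable_fun_mx => i j; rewrite /refl; under eq_fun do rewrite !mxE.
apply: measurable_funB => //; apply: measurable_funM => //.
apply: measurable_sum => k; under eq_fun do rewrite mxE.
exact: measurable_funM.
Qed.

Lemma measurable_lift_orth n :
  measurable_fun setT (@lift_orth R n : borel_mx R n n -> borel_mx R n.+1 n.+1).
Proof.
apply: measurable_fun_mx => i j; rewrite /lift_orth.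
under eq_fun do rewrite mxE; case: splitP => i' _;
  under eq_fun do rewrite mxE; case: splitP => j' _;
  by [exact: measurable_cst|exact: measurable_entry].
Qed.

Lemma measurable_orthogonal n :
  measurable (orthogonal n : set (borel_mx R n n)).
Proof.
have m1 : measurable_fun setT ((fun M => M *m M^T) : borel_mx R n n -> borel_mx R n n).
  by apply: measurable_fun_mulmx => //; exact: measurable_fun_tr.
have -> : orthogonal n = \bigcap_(ij in [set: 'I_n * 'I_n])
    [set M | (M *m M^T) ij.1 ij.2 = (1%:M : 'M[R]_n) ij.1 ij.2].
  apply/seteqP; split => [M MM [i j] _|M h]; first by rewrite /= MM.
  by apply/matrixP => i j; exact: (h (i, j)).
apply: fin_bigcap_measurable => // -[i j] _; apply: measurable_eq_cst.
exact: (measurableT_comp (@measurable_entry R n n i j)).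
Qed.

Definition haar_orth n (nu : probability (borel_mx R n n) R) :=
  nu (orthogonal n) = 1%E /\
  forall Q : 'M[R]_n, Q *m Q^T = 1%:M -> preserves nu (fun M => M *m Q).

(** A random orthogonal matrix is obtained from a uniform unit vector [y], which
    becomes its first row, and from a random orthogonal matrix of smaller size
    acting on the orthogonal complement of [e_0], transported to that of [y] by
    the reflection exchanging [e_0] and [y]. *)
Section step.
Variables (n : nat) (nu : probability (borel_mx R n n) R).
Variables (mu : probability (borel_rV R n.+1) R).
Hypotheses (hnu : haar_orth nu) (hmu : haar_sphere fullv mu).

Let e : 'rV[R]_n.+1 := e_0 R n.

Let g (p : borel_rV R n.+1 * borel_mx R n n) : borel_mx R n.+1 n.+1 :=
  lift_orth p.2 *m refl (e - p.1).

Let mg : measurable_fun setT g.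
Proof.
apply: measurable_fun_mulmx.
  apply: (measurableT_comp (@measurable_lift_orth n)).
  exact: measurable_snd.
apply: measurable_refl; apply: measurable_fun_mx => i j.
under eq_fun do rewrite !mxE; apply: measurable_funB => //.
apply: (measurableT_comp (@measurable_entry R 1 n.+1 i j)).
exact: measurable_fst.
Qed.

(** [M *m refl (e - y) *m Q], with [M] fixing [e], is again of the form
    [M' *m refl (e - y')], with [y' = y *m Q] and [M'] a rotation of [M] that
    depends on [y] only. *)
Let turn (y : 'rV[R]_n.+1) (Q : 'M[R]_n.+1) : dot y y = 1 -> Q *m Q^T = 1%:M ->
  exists2 K : 'M[R]_n, K *m K^T = 1%:M &
    refl (e - y) *m Q = lift_orth K *m refl (e - y *m Q).
Proof.
move=> yy QQ.
have ey : e *m refl (e - y) = y by apply: refl_swap; rewrite dot_e_0 yy.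
have eyQ : e *m refl (e - y *m Q) = y *m Q.
  by apply: refl_swap; rewrite dot_e_0 dot_orth.
have [||K KK KE] := @orth_fix_e_0 R n (refl (e - y) *m Q *m refl (e - y *m Q)).
- by apply: orthM; [apply: orthM => //; exact: refl_orth|exact: refl_orth].
- by rewrite !mulmxA -/e ey -{1}eyQ reflK.
exists K => //; rewrite -KE -[RHS]mulmxA.
by rewrite -{2}(refl_tr (e - y *m Q)) refl_orth mulmx1.
Qed.

Let nu' : probability (borel_mx R n.+1 n.+1) R := push (mu \x nu)%E mg.

Let orth_sphere y : sphere n.+1 y -> dot y y = 1 :> R. Proof. by []. Qed.

Let preserves_step (Q : 'M[R]_n.+1) : Q *m Q^T = 1%:M ->
  preserves nu' (fun M => M *m Q).
Proof.
move=> QQ A mA.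
have mgA : measurable (g @^-1` A) by rewrite -[X in measurable X]setTI; exact: mg.
have mQA : measurable ((fun M : borel_mx R n.+1 n.+1 => M *m Q : borel_mx R n.+1 n.+1) @^-1` A).
  by rewrite -[X in measurable X]setTI; exact: measurable_mulmx_cst.
pose psi (y : borel_rV R n.+1) := nu (xsection (g @^-1` A) y).
have mpsi : measurable_fun setT psi by exact: measurable_fun_xsection.
have psi0 y : (0 <= psi y)%E by exact: measure_ge0.
have mulQ : measurable_fun setT
    ((fun y => y *m Q) : borel_rV R n.+1 -> borel_rV R n.+1).
  exact: measurable_mulmxr.
transitivity (\int[mu]_y psi (y *m Q))%E; last first.
  transitivity (\int[push mu mulQ]_y psi y)%E.
    by rewrite ge0_integral_pushforward.
  apply: eq_measure_integral => B mB _.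
  by have [_ h] := hmu; apply: h => // x _; exact: memvf.
rewrite /nu' /= /push /pushforward /= /product_measure1.
apply: ge0_ae_eq_integral => //.
- apply: measurable_fun_xsection; rewrite -[X in measurable X]setTI.
  exact: mg.
- exact: (measurableT_comp mpsi mulQ).
exists (~` (sphere n.+1 `&` [set` fullv])); split.
- by apply: measurableC; exact: measurable_sphereI.
- transitivity (1 - mu (sphere n.+1 `&` [set` fullv]))%E.
    by apply: probability_setC; exact: measurable_sphereI.
  by have [-> _] := hmu; rewrite subee.
move=> y /=; apply: contra_not => -[sy _] _.
have [K KK KE] := turn (orth_sphere sy) QQ.
have [_ /(_ K KK) pK] := hnu.
rewrite /psi -[RHS]pK; last exact: measurable_xsection.
congr (nu _); rewrite !xsectionE; apply/seteqP.
by split => M; rewrite /g /= lift_orthM -!mulmxA KE.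
Qed.

Lemma haar_orth_step : exists nu1 : probability (borel_mx R n.+1 n.+1) R,
  haar_orth nu1.
Proof.
exists nu'; split; last exact: preserves_step.
apply/eqP; rewrite eq_le probability_le1 /=; last exact: measurable_orthogonal.
have [nu1 _] := hnu.
have <- : (mu \x nu)%E ([set: borel_rV R n.+1] `*` orthogonal n) = 1%E.
  rewrite product_measure1E//; last exact: measurable_orthogonal.
  by rewrite [X in (X * _)%E]probability_setT mul1e.
apply: le_measure; rewrite ?inE.
- by apply: measurableX => //; exact: measurable_orthogonal.
- by rewrite -[X in measurable X]setTI; apply: mg => //; exact: measurable_orthogonal.
move=> [y M] [_ /= MM]; apply: orthM; last exact: refl_orth.
by rewrite lift_orth_tr -lift_orthM MM lift_orth1.
Qed.

End step.

Lemma haar_orth_exists n : exists nu : probability (borel_mx R n n) R, haar_orth nu.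
Proof.
elim: n => [|n [nu hnu]]; last first.
  have [|mu hmu] := @haar_sphere_exists R n.+1 fullv.
    by rewrite dimvf /dim /= mul1n.
  exact: haar_orth_step hnu hmu.
have x0 (M : 'M[R]_0) : M = 0 by apply/matrixP => -[].
exists (dirac (0 : borel_mx R 0 0)); split.
  by rewrite /= diracE mem_set//; rewrite /orthogonal /=; apply/matrixP => -[].
by move=> Q _ A mA; congr (dirac _ _); apply/seteqP; split => M /=;
  rewrite (x0 M) (x0 (_ *m _)).
Qed.

End haar_orthogonal.
Arguments orthogonal {R} n.

(** * Integrals of bounded measurable functions *)

Section bmeas.
Context d (T : measurableType d) (R : realType).
Implicit Types (D : set T) (f g : T -> R).

Definition bmeas D f :=
  measurable_fun D f /\ exists C : R, forall x, D x -> `|f x| <= C.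

Lemma bmeas_cst D c : bmeas D (cst c).
Proof. by split; [exact: measurable_cst|exists `|c|]. Qed.

Lemma bmeasD D f g : bmeas D f -> bmeas D g -> bmeas D (fun x => f x + g x).
Proof.
move=> [mf [C hC]] [mg [C' hC']]; split; first exact: measurable_funD.
by exists (C + C') => x Dx; rewrite (le_trans (ler_normD _ _))// lerD ?hC ?hC'.
Qed.

Lemma bmeasM D f g : bmeas D f -> bmeas D g -> bmeas D (fun x => f x * g x).
Proof.
move=> [mf [C hC]] [mg [C' hC']]; split; first exact: measurable_funM.
by exists (C * C') => x Dx; rewrite normrM ler_pM ?hC ?hC'.
Qed.

Lemma bmeasZ D f c : bmeas D f -> bmeas D (fun x => c * f x).
Proof. by move=> hf; apply: bmeasM => //; exact: bmeas_cst. Qed.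

Lemma bmeasB D f g : bmeas D f -> bmeas D g -> bmeas D (fun x => f x - g x).
Proof.
move=> hf hg; have h := bmeasD hf (bmeasZ (-1) hg).
by under eq_fun do rewrite -mulN1r.
Qed.

Lemma bmeasX D f j : bmeas D f -> bmeas D (fun x => f x ^+ j).
Proof.
move=> hf; elim: j => [|j IH].
  by under eq_fun do rewrite expr0; exact: bmeas_cst.
by under eq_fun do rewrite exprS; exact: bmeasM.
Qed.

Lemma bmeas_sum D (I : Type) (s : seq I) (f : I -> T -> R) :
  (forall i, bmeas D (f i)) -> bmeas D (fun x => \sum_(i <- s) f i x).
Proof.
move=> hf; elim: s => [|i s IH].
  by under eq_fun do rewrite big_nil; exact: bmeas_cst.
by under eq_fun do rewrite big_cons; exact: bmeasD.
Qed.

Variable P : probability T R.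

Lemma bmeas_integrable D f : measurable D -> bmeas D f ->
  P.-integrable D (EFin \o f).
Proof.
move=> mD [mf [C hC]]; apply: measurable_bounded_integrable => //.
  by rewrite (le_lt_trans (probability_le1 _ _))// ltry.
exists C; split; first exact: num_real.
by move=> M CM x Dx; exact: le_trans (hC x Dx) (ltW CM).
Qed.

Variables (D : set T) (mD : measurable D).

Local Notation EX f := (\int[P]_(x in D) f x).

Lemma EX_D f g : bmeas D f -> bmeas D g -> EX (fun x => f x + g x) = EX f + EX g.
Proof. by move=> hf hg; rewrite RintegralD//; exact: bmeas_integrable. Qed.

Lemma EX_B f g : bmeas D f -> bmeas D g -> EX (fun x => f x - g x) = EX f - EX g.
Proof. by move=> hf hg; rewrite RintegralB//; exact: bmeas_integrable. Qed.

Lemma EX_Z c f : bmeas D f -> EX (fun x => c * f x) = c * EX f.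
Proof. by move=> hf; rewrite RintegralZl//; exact: bmeas_integrable. Qed.

Lemma EX_sum (I : Type) (s : seq I) (f : I -> T -> R) :
  (forall i, bmeas D (f i)) ->
  EX (fun x => \sum_(i <- s) f i x) = \sum_(i <- s) EX (f i).
Proof.
move=> hf; elim: s => [|i s IH].
  by under eq_Rintegral do rewrite big_nil; rewrite Rintegral_cst// mul0r big_nil.
under eq_Rintegral do rewrite big_cons.
by rewrite EX_D// ?IH ?big_cons//; exact: bmeas_sum.
Qed.

Lemma EX_le f g : bmeas D f -> bmeas D g -> (forall x, D x -> f x <= g x) ->
  EX f <= EX g.
Proof. by move=> hf hg; apply: le_Rintegral => //; exact: bmeas_integrable. Qed.

Lemma EX_cst c : P D = 1%E -> EX (cst c) = c.
Proof.
by move=> PD; rewrite Rintegral_cst// (_ : fine _ = 1) ?mulr1//= PD.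
Qed.

Lemma EX_eq f g : (forall x, D x -> f x = g x) -> EX f = EX g.
Proof. by move=> fg; apply: eq_Rintegral => x /[!inE]; exact: fg. Qed.

End bmeas.

Section transfer.
Context d1 d2 (T1 : measurableType d1) (T2 : measurableType d2) (R : realType).

Lemma bmeas_comp (phi : T1 -> T2) (D : set T2) (f : T2 -> R) :
  measurable_fun setT phi -> measurable D ->
  bmeas D f -> bmeas (phi @^-1` D) (f \o phi).
Proof.
move=> mphi mD [mf [C hC]]; split; last by exists C => x; exact: hC.
apply: (measurable_comp mD) => //; first by move=> _ [x Dx <-].
exact: measurable_funTS.
Qed.

Lemma EX_push (P1 : probability T1 R) (P2 : probability T2 R) (phi : T1 -> T2)
    (D : set T2) (f : T2 -> R) :
  measurable_fun setT phi ->
  (forall A, measurable A -> P1 (phi @^-1` A) = P2 A) ->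
  measurable D -> bmeas D f ->
  \int[P1]_(x in phi @^-1` D) f (phi x) = \int[P2]_(y in D) f y.
Proof.
move=> mphi P12 mD hf.
have mphiD : measurable (phi @^-1` D) by rewrite -[X in measurable X]setTI; exact: mphi.
have [mf _] := hf.
pose h := (EFin \o f) \_ D.
have mh : measurable_fun setT h.
  by apply/(measurable_restrictT _ mD); exact/measurable_EFinP.
rewrite /Rintegral; congr fine.
transitivity (\int[P2]_(y in D) h y)%E; last first.
  by apply: eq_integral => y yD; rewrite /h patchE yD.
transitivity (\int[push P1 mphi]_(y in D) h y)%E; last first.
  by apply: eq_measure_integral => A mA _; exact: P12.
rewrite /push integral_pushforward//.
  by apply: eq_integral => x /[!inE] xD; rewrite /= /h patchE mem_set.
apply: (@eq_integrable _ _ _ _ _ mphiD (EFin \o (f \o phi))).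
  by move=> x /[!inE] xD; rewrite /= /h patchE mem_set.
by apply: bmeas_integrable => //; exact: bmeas_comp.
Qed.

Variables (P1 : probability T1 R) (P2 : probability T2 R).
Variables (D1 : set T1) (D2 : set T2) (mD1 : measurable D1) (mD2 : measurable D2).
Variable f : T1 * T2 -> R.
Hypothesis hf : bmeas (D1 `*` D2) f.

Let h : T1 * T2 -> R := f \_ (D1 `*` D2).

Let mh : measurable_fun setT h.
Proof.
by apply/(measurable_restrictT _ (measurableX mD1 mD2)); case: hf.
Qed.

Let hC : exists2 C : R, 0 <= C & forall p, `|h p| <= C.
Proof.
have [_ [C fC]] := hf; exists `|C| => // p; rewrite /h patchE.
by case: ifPn => [/[!inE] /fC|_]; [move/le_trans; apply; exact: ler_norm|rewrite normr0].
Qed.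

Let hE1 x : D1 x -> \int[P2]_(y in D2) f (x, y) = \int[P2]_y h (x, y).
Proof.
move=> D1x; rewrite Rintegral_mkcond; apply: eq_Rintegral => y _.
rewrite /h !patchE; case: ifPn => yD.
  by rewrite mem_set//; split => //; exact/set_mem.
by rewrite ifN// notin_setE => -[_ /= /mem_set yD2]; rewrite yD2 in yD.
Qed.

Let hE2 y : D2 y -> \int[P1]_(x in D1) f (x, y) = \int[P1]_x h (x, y).
Proof.
move=> D2y; rewrite Rintegral_mkcond; apply: eq_Rintegral => x _.
rewrite /h !patchE; case: ifPn => xD.
  by rewrite mem_set//; split => //; exact/set_mem.
by rewrite ifN// notin_setE => -[/= /mem_set xD1]; rewrite xD1 in xD.
Qed.

Let bh : bmeas setT h.
Proof. by split => //; have [C _ h1] := hC; exists C => p _. Qed.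

Let ih : (P1 \x P2)%E.-integrable setT (EFin \o h).
Proof. exact: bmeas_integrable. Qed.

Lemma bmeas_EX : bmeas D1 (fun x => \int[P2]_(y in D2) f (x, y)).
Proof.
have [C C0 h1] := hC.
have mx x : measurable_fun setT (fun y => h (x, y)) by exact: measurable_fun_pair2.
have bx x : bmeas setT (fun y => h (x, y)) by split => //; exists C => y _.
have b : bmeas D1 (fun x => \int[P2]_y h (x, y)).
  split.
    apply: measurable_funTS.
    apply: measurableT_comp => //.
    exact: (measurable_fubini_F ih).
  exists C => x _; apply: le_trans (le_normr_Rintegral _ _) _ => //.
    exact: bmeas_integrable.
  rewrite -[leRHS](EX_cst measurableT C (probability_setT P2)).
  apply: EX_le => //; last exact: bmeas_cst.
  split; first exact: measurableT_comp.
  by exists C => y _; rewrite normr_id.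
have [mb [C' bC]] := b; split; last first.
  by exists C' => x D1x; rewrite hE1//; exact: bC.
by apply: eq_measurable_fun mb => x /[!inE] D1x; rewrite hE1.
Qed.

Lemma EX_Fubini :
  \int[P1]_(x in D1) \int[P2]_(y in D2) f (x, y) =
  \int[P2]_(y in D2) \int[P1]_(x in D1) f (x, y).
Proof.
transitivity (\int[P1]_x \int[P2]_y h (x, y)).
  rewrite Rintegral_mkcond; apply: eq_Rintegral => x _; rewrite patchE.
  case: ifPn => [/[!inE]|]; first exact: hE1.
  rewrite notin_setE => nx; apply/esym.
  transitivity (\int[P2]_y (cst 0 y)); last by rewrite Rintegral_cst// mul0r.
  by apply: eq_Rintegral => y _; rewrite /h patchE ifN// notin_setE => -[].
transitivity (\int[P2]_y \int[P1]_x h (x, y)); last first.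
  rewrite [RHS]Rintegral_mkcond; apply: eq_Rintegral => y _; rewrite patchE.
  case: ifPn => [/[!inE] /hE2 ->//|].
  rewrite notin_setE => ny.
  transitivity (\int[P1]_x (cst 0 x)); last by rewrite Rintegral_cst// mul0r.
  by apply: eq_Rintegral => x _; rewrite /h patchE ifN// notin_setE => -[].
have [C C0 h1] := hC.
have bx x : bmeas setT (fun y => h (x, y)).
  by split; [exact: measurable_fun_pair2|exists C => y _].
have by_ y : bmeas setT (fun x => h (x, y)).
  by split; [exact: measurable_fun_pair1|exists C => x _].
have := Fubini ih; rewrite /Rintegral => H; congr fine.
transitivity (\int[P1]_x \int[P2]_y (h (x, y))%:E)%E.
  apply: eq_integral => x _; rewrite fineK//.
  apply: integrable_fin_num => //.
  exact: (bmeas_integrable P2 measurableT (bx x)).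
rewrite [LHS]H; apply: eq_integral => y _; rewrite fineK//.
apply: integrable_fin_num => //.
exact: (bmeas_integrable P1 measurableT (by_ y)).
Qed.

End transfer.

(** * Moments of isotropic random vectors *)

Section polynomial_identities.
Variable R : realType.

Lemma eq_poly_horner (p q : {poly R}) : (forall s, p.[s] = q.[s]) -> p = q.
Proof.
move=> pq; apply/eqP; rewrite -subr_eq0; set r := p - q.
apply/negPn/negP => r0.
pose rs : seq R := [seq i%:R | i <- iota 0 (size r)].
have : (size rs < size r)%N.
  apply: max_poly_roots => //.
    by apply/allP => x _; rewrite /root hornerD hornerN pq subrr.
  rewrite map_inj_uniq ?iota_uniq// => i j /eqP.
  by rewrite eqr_nat => /eqP.
by rewrite size_map size_iota ltnn.
Qed.

Lemma coef_exp_low (q : {poly R}) n :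
  [/\ (q ^+ n)`_0 = q`_0 ^+ n, (q ^+ n)`_1 = n%:R * q`_0 ^+ n.-1 * q`_1 &
      (q ^+ n)`_2 = n%:R * q`_0 ^+ n.-1 * q`_2 +
        n%:R * n.-1%:R / 2 * q`_0 ^+ n.-2 * q`_1 ^+ 2].
Proof.
elim: n => [|n [h0 h1 h2]].
  by rewrite !expr0 !coef1 /=; split; ring.
rewrite exprS; split; rewrite coefM !big_ord_recl big_ord0 /= /bump /=.
- by rewrite h0 addr0 exprS.
- rewrite h0 h1; case: n {h0 h1 h2} => [|n] /=; first by rewrite expr0; ring.
  by rewrite !exprS -!natr1; ring.
- rewrite h0 h1 h2.
  case: n {h0 h1 h2} => [|[|n]] /=; rewrite ?expr0 ?expr1; try by field.
  by rewrite !exprS -!natr1; field.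
Qed.

End polynomial_identities.

Section moments.
Context d (T : measurableType d) (R : realType) (n : nat).
Variables (P : probability T R) (D : set T) (mD : measurable D).
Variables (z : T -> 'rV[R]_n) (G : T -> R).
Hypotheses (bz : forall i, bmeas D (fun t => z t 0 i)) (bG : bmeas D G).
Implicit Types (V : {vspace 'rV[R]_n}) (v w : 'rV[R]_n).

Local Notation EX f := (\int[P]_(x in D) f x).

Lemma bmeas_dot w : bmeas D (fun t => dot (z t) w).
Proof.
by apply: bmeas_sum => i; apply: bmeasM => //; exact: bmeas_cst.
Qed.

Definition sqproj V t := dot (proj V (z t)) (proj V (z t)).

Lemma sqprojE V t :
  sqproj V t = \sum_i dot (z t) (proj V (basis_vec R i)) ^+ 2.
Proof. by rewrite /sqproj -sum_dot_proj_basis; apply: eq_bigr => i _; rewrite expr2. Qed.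

Lemma bmeas_sqproj V : bmeas D (sqproj V).
Proof.
rewrite (_ : sqproj V = fun t => \sum_i dot (z t) (proj V (basis_vec R i)) ^+ 2).
  by apply: bmeas_sum => i; apply: bmeasX; exact: bmeas_dot.
by apply/funext => t; exact: sqprojE.
Qed.

(** Rotation invariance in [V] forces the [2j]-th moments in the directions of
    [V] to be proportional to the [2j]-th power of the length.  Recording only
    this consequence, with its constant, makes it pass to subspaces of [V]. *)
Definition isotropic V j A := forall w, w \in V ->
  EX (fun t => G t * dot (z t) w ^+ (2 * j)) = A * dot w w ^+ j.

Lemma isotropic_sub U V j A : (U <= V)%VS -> isotropic V j A -> isotropic U j A.
Proof. by move=> /subvP UV iV w /UV; exact: iV. Qed.

Let EX_expand j w v (s : R) :
  EX (fun t => G t * dot (z t) (w + s *: v) ^+ j) =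
  \sum_(i < j.+1) 'C(j, i)%:R *
    EX (fun t => G t * (dot (z t) w ^+ (j - i) * dot (z t) v ^+ i)) * s ^+ i.
Proof.
have bi (i : nat) :
    bmeas D (fun t => G t * (dot (z t) w ^+ (j - i) * dot (z t) v ^+ i)).
  by apply: bmeasM => //; apply: bmeasM; apply: bmeasX; exact: bmeas_dot.
transitivity (EX (fun t => \sum_(i < j.+1) ('C(j, i)%:R * s ^+ i) *
    (G t * (dot (z t) w ^+ (j - i) * dot (z t) v ^+ i)))).
  apply: EX_eq => t _; rewrite dotDr dotZr exprDn mulr_sumr.
  by apply: eq_bigr => i _; rewrite -mulr_natr exprMn; ring.
rewrite EX_sum//; last by move=> i; exact: bmeasZ.
by apply: eq_bigr => i _; rewrite EX_Z//; ring.
Qed.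

(** Comparison of the coefficients of [s ^+ 2] in the two expressions of the
    [2j + 2]-th moment in the direction [w + s *: v]. *)
Lemma isotropic_polar V j A v w : isotropic V j.+1 A -> v \in V -> w \in V ->
  (2 * j%:R + 1) * EX (fun t => G t * (dot (z t) w ^+ (2 * j) * dot (z t) v ^+ 2)) =
  A * (dot w w ^+ j * dot v v + 2 * j%:R * dot w w ^+ j.-1 * dot w v ^+ 2).
Proof.
move=> iso vV wV.
pose p := \poly_(i < (2 * j.+1).+1) ('C(2 * j.+1, i)%:R *
  EX (fun t => G t * (dot (z t) w ^+ (2 * j.+1 - i) * dot (z t) v ^+ i))).
pose q0 := (dot w w)%:P + (2 * dot w v) *: 'X + dot v v *: 'X^2.
pose q := A *: q0 ^+ j.+1.
have pq : p = q.
  apply: eq_poly_horner => s; rewrite horner_poly -EX_expand.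
  rewrite iso; last by rewrite rpredD// rpredZ.
  rewrite /q /q0 hornerZ horner_exp !hornerD !hornerZ hornerC hornerX hornerXn.
  by rewrite dot_sqrD !dotZr dotZl; congr (_ * _ ^+ _); ring.
have /(congr1 (fun r : {poly R} => r`_2)) := pq.
rewrite coef_poly mulnS add2n ltnS /= coefZ.
have [_ _ ->] := coef_exp_low q0 j.+1.
have -> : q0`_0 = dot w w by rewrite !coefD !coefZ coefC coefX coefXn /=; ring.
have -> : q0`_1 = 2 * dot w v by rewrite !coefD !coefZ coefC coefX coefXn /=; ring.
have -> : q0`_2 = dot v v by rewrite !coefD !coefZ coefC coefX coefXn /=; ring.
rewrite subSS subSS subn0 => h.
have b2 : 'C((2 * j).+2, 2)%:R = (j%:R + 1) * (2 * j%:R + 1) :> R.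
  have : ('C((2 * j).+2, 2) * 2 = (2 * j).+2 * (2 * j).+1)%N.
    by have := bin_ffact (2 * j).+2 2; rewrite !ffactnS ffactn0 muln1.
  rewrite -[X in (_ = X * _)%N]addn2 -[X in (_ = _ * X)%N]addn1.
  move=> /(congr1 (fun k => k%:R : R)); rewrite !(natrM, natrD) => e.
  by apply: (@mulIf _ 2) => //; rewrite e; ring.
have j1 : j%:R + 1 != 0 :> R by rewrite natr1 pnatr_eq0.
apply: (mulfI j1); rewrite mulrA -b2 h /= -natr1.
by field.
Qed.

(** The sum of [isotropic_polar] over the projections [v] of the basis vectors
    to [V]: the squares add up to [sqproj V], and the trace to [\dim V]. *)
Lemma isotropic_step V j A w : isotropic V j.+1 A -> w \in V ->
  (2 * j%:R + 1) * EX (fun t => G t * (dot (z t) w ^+ (2 * j) * sqproj V t)) =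
  A * ((\dim V)%:R + 2 * j%:R) * dot w w ^+ j.
Proof.
move=> iso wV; pose b i := proj V (basis_vec R i).
have bi i : bmeas D (fun t => G t * (dot (z t) w ^+ (2 * j) * dot (z t) (b i) ^+ 2)).
  by apply: bmeasM => //; apply: bmeasM; apply: bmeasX; exact: bmeas_dot.
transitivity (\sum_i (2 * j%:R + 1) *
    EX (fun t => G t * (dot (z t) w ^+ (2 * j) * dot (z t) (b i) ^+ 2))).
  rewrite -mulr_sumr -EX_sum//; congr (_ * _); apply: EX_eq => t _.
  by rewrite sqprojE -!mulr_sumr.
under eq_bigr do rewrite (isotropic_polar iso (memv_eproj V _) wV).
rewrite -mulr_sumr -[RHS]mulrA; congr (_ * _); rewrite big_split /= -!mulr_sumr.
rewrite sum_dot_proj_proj.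
have -> : \sum_i dot w (proj V (basis_vec R i)) ^+ 2 = dot w w.
  transitivity (dot (proj V w) (proj V w)); last by rewrite proj_id.
  by rewrite -sum_dot_proj_basis; apply: eq_bigr => i _; rewrite expr2.
case: j {iso bi} => [|j] /=; first by rewrite expr0; ring.
by rewrite exprS; ring.
Qed.

Lemma moment2 V A : isotropic V 1 A ->
  EX (fun t => G t * sqproj V t) = A * (\dim V)%:R.
Proof.
move=> iso; have := isotropic_step iso (mem0v V).
rewrite mulr0 expr0 add0r mul1r addr0 mulr1 => <-.
by apply: EX_eq => t _; rewrite muln0 expr0 mul1r.
Qed.

Lemma moment4 V A : isotropic V 2 A ->
  3 * EX (fun t => G t * sqproj V t ^+ 2) = A * ((\dim V)%:R * ((\dim V)%:R + 2)).
Proof.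
move=> iso; pose b i := proj V (basis_vec R i).
have bi i : bmeas D (fun t => G t * (dot (z t) (b i) ^+ 2 * sqproj V t)).
  apply: bmeasM => //; apply: bmeasM; last exact: bmeas_sqproj.
  by apply: bmeasX; exact: bmeas_dot.
transitivity (\sum_i 3 * EX (fun t => G t * (dot (z t) (b i) ^+ 2 * sqproj V t))).
  rewrite -mulr_sumr -EX_sum//; congr (_ * _); apply: EX_eq => t _.
  by rewrite -mulr_sumr -mulr_suml -sqprojE expr2.
transitivity (\sum_i A * ((\dim V)%:R + 2) * dot (b i) (b i)).
  apply: eq_bigr => i _; have := isotropic_step iso (memv_eproj V (basis_vec R i)).
  rewrite muln1 expr1 mulr1 => <-; congr (_ * _); ring.
by rewrite -mulr_sumr sum_dot_proj_proj; ring.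
Qed.


(** The moments in the directions of [V] only depend on the length, hence are
    determined by their homogeneity. *)
Lemma isotropic_exists V : (0 < \dim V)%N ->
  (forall w w' j, w \in V -> w' \in V -> dot w w = dot w' w' ->
    EX (fun t => G t * dot (z t) w ^+ j) = EX (fun t => G t * dot (z t) w' ^+ j)) ->
  exists A, forall j, isotropic V j (A j).
Proof.
move=> V0 inv'; pose u := vpick V.
have uV : u \in V by exact: memv_pick.
have uu : 0 < dot u u by apply: dot_gt0; rewrite vpick0 -dimv_eq0 -lt0n.
exists (fun j => EX (fun t => G t * dot (z t) u ^+ (2 * j)) / dot u u ^+ j).
move=> j w wV; pose a := Num.sqrt (dot w w / dot u u).
have a2 : a ^+ 2 = dot w w / dot u u.
  by rewrite sqr_sqrtr// divr_ge0// ?dot_ge0// ltW.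
rewrite (inv' w (a *: u)) ?rpredZ//; last first.
  by rewrite dotZl dotZr mulrA -expr2 a2 divfK// gt_eqF.
transitivity (a ^+ (2 * j) * EX (fun t => G t * dot (z t) u ^+ (2 * j))).
  rewrite -EX_Z//; last by apply: bmeasM => //; apply: bmeasX; exact: bmeas_dot.
  by apply: EX_eq => t _; rewrite dotZr exprMn; ring.
by rewrite exprM a2 expr_div_n; ring.
Qed.

(** With [r = \dim U] and [e = \dim V], the means of [sqproj U] and of its square
    are those of [r / e * s] and [r * (r + 2) / (e * (e + 2)) * s ^+ 2], where
    [s = sqproj V].  Since the second coefficient exceeds the square of the first
    one when [r < e], the squared projection to [U] cannot concentrate around
    [a]; the constant below is what remains once the square in [s] has been
    completed. *)
Lemma sqproj_spread U V (a : R) : (U <= V)%VS -> (0 < \dim U)%N ->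
  (forall w w' j, w \in V -> w' \in V -> dot w w = dot w' w' ->
    EX (fun t => G t * dot (z t) w ^+ j) = EX (fun t => G t * dot (z t) w' ^+ j)) ->
  (forall t, D t -> 0 <= G t) ->
  0 <= EX (fun t => G t * ((sqproj U t - a) ^+ 2 -
    a ^+ 2 * (2 * ((\dim V)%:R - (\dim U)%:R) / ((\dim V)%:R * ((\dim U)%:R + 2))))).
Proof.
move=> UV U0 inv' G0.
have V0 : (0 < \dim V)%N by exact: leq_trans U0 (dimvS UV).
have [A iso] := isotropic_exists V0 inv'.
have bU := bmeas_sqproj U; have bV := bmeas_sqproj V.
set r : R := (\dim U)%:R; set e : R := (\dim V)%:R.
have r0 : 0 < r by rewrite ltr0n.
have e0 : 0 < e by rewrite ltr0n.
set k := a ^+ 2 * _.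
pose M1 V' := EX (fun t => G t * sqproj V' t).
pose M2 V' := EX (fun t => G t * sqproj V' t ^+ 2).
have m2U : M1 U = A 1%N * r := moment2 (isotropic_sub UV (iso 1%N)).
have m4U : 3 * M2 U = A 2%N * (r * (r + 2)) :=
  moment4 (isotropic_sub UV (iso 2%N)).
have m2V : M1 V = A 1%N * e := moment2 (iso 1%N).
have m4V : 3 * M2 V = A 2%N * (e * (e + 2)) := moment4 (iso 2%N).
have b1 V' : bmeas D (fun t => G t * sqproj V' t).
  by apply: bmeasM => //; exact: bmeas_sqproj.
have b2 V' : bmeas D (fun t => G t * sqproj V' t ^+ 2).
  by apply: bmeasM => //; apply: bmeasX; exact: bmeas_sqproj.
have expand V' (al be ga : R) :
    EX (fun t => G t * (al * sqproj V' t ^+ 2 + be * sqproj V' t + ga)) =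
    al * M2 V' + be * M1 V' + ga * EX G.
  rewrite /M1 /M2 -!EX_Z// -!EX_D//; [|by apply: bmeasD; exact: bmeasZ|exact: bmeasZ..].
  by apply: EX_eq => t _; ring.
clearbody M1 M2.
have -> : EX (fun t => G t * ((sqproj U t - a) ^+ 2 - k)) =
    EX (fun t => G t * ((r * (r + 2) / (e * (e + 2))) * sqproj V t ^+ 2 +
      (- 2 * a * r / e) * sqproj V t + (a ^+ 2 - k))).
  transitivity (EX (fun t => G t * (1 * sqproj U t ^+ 2 +
      (- 2 * a) * sqproj U t + (a ^+ 2 - k)))).
    by apply: EX_eq => t _; ring.
  rewrite [LHS]expand [RHS]expand m2U m2V; congr (_ + _ + _); last by field; rewrite gt_eqF.
  apply: (@mulfI _ 3) => //; rewrite mul1r m4U [RHS]mulrCA m4V; field.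
  by rewrite !gt_eqF// addr_gt0.
apply: Rintegral_ge0 => t Dt; rewrite mulr_ge0 ?G0//.
set s := sqproj V t.
have -> : r * (r + 2) / (e * (e + 2)) * s ^+ 2 + - 2 * a * r / e * s + (a ^+ 2 - k) =
    r * (r + 2) / (e * (e + 2)) * (s - a * (e + 2) / (r + 2)) ^+ 2.
  by rewrite /k; field; rewrite !gt_eqF// addr_gt0.
by rewrite mulr_ge0 ?sqr_ge0// divr_ge0// mulr_ge0// ?addr_ge0// ltW.
Qed.

End moments.

(** * Radon transforms of even polynomials in one direction *)

Section sphere_integrals.
Variables (R : realType) (n : nat) (E : {vspace 'rV[R]_n}).
Variable mu : probability (borel_rV R n) R.
Hypothesis hmu : haar_sphere E mu.

Let X : set (borel_rV R n) := sphere n `&` [set` E].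

Let mX : measurable X. Proof. exact: measurable_sphereI. Qed.

Lemma sphere_entry_le1 (x : 'rV[R]_n) i : sphere n x -> `|x 0 i| <= 1.
Proof.
move=> sx; rewrite -(@ler_pXn2r _ 2) ?nnegrE// real_normK ?num_real// expr1n.
rewrite -[leRHS]sx /dot (bigD1 i)//= -expr2 lerDl.
by apply: sumr_ge0 => j _; rewrite -expr2 sqr_ge0.
Qed.

Lemma bmeas_sphere_entry i : bmeas X (fun x : borel_rV R n => x 0 i).
Proof.
split; first by apply: measurable_funTS; exact: measurable_entry.
by exists 1 => x [sx _]; exact: sphere_entry_le1.
Qed.

Lemma haar_integral_orth (Q : 'M[R]_n) (f : borel_rV R n -> R) :
  Q *m Q^T = 1%:M -> (forall x, x \in E -> x *m Q \in E) -> bmeas X f ->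
  \int[mu]_(x in X) f (x *m Q) = \int[mu]_(x in X) f x.
Proof.
move=> QQ QE bf.
rewrite -[RHS](@EX_push _ _ _ _ _ mu mu (fun x => x *m Q) X f)//; last 2 first.
- exact: measurable_mulmxr.
- by case: hmu => _ inv A mA; exact: inv.
suff -> : (fun x : 'rV[R]_n => x *m Q) @^-1` X = X by [].
apply/seteqP; split => x; rewrite /X /sphere /= dot_orth// => -[sx xE]; split => //.
  move: xE; rewrite -{1}(img_stable QQ QE) => /mem_img_mxP[y yE].
  by move/(orth_inj QQ) => ->.
exact: QE.
Qed.

Lemma haar_isotropic w w' j : w \in E -> w' \in E -> dot w w = dot w' w' ->
  \int[mu]_(x in X) (1 * dot x w ^+ j) = \int[mu]_(x in X) (1 * dot x w' ^+ j).
Proof.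
move=> wE w'E ww'; set Q := refl (w - w').
rewrite -(@haar_integral_orth Q)//; first last.
- apply: bmeasM; first exact: bmeas_cst.
  by apply: bmeasX; apply: bmeas_dot => i; exact: bmeas_sphere_entry.
- by move=> x xE; apply: refl_stable => //; rewrite rpredB.
- exact: refl_orth.
by apply: EX_eq => x _; rewrite dot_mulmx refl_tr refl_swap.
Qed.

(** The even moments of a coordinate of a uniform point of [S^(m - 1)]. *)
Fixpoint sphere_moment (m j : nat) : R :=
  if j is i.+1 then sphere_moment m i * (2 * i%:R + 1) / (m%:R + 2 * i%:R)
  else 1.

Lemma sphere_moment_gt0 m j : (0 < m)%N -> 0 < sphere_moment m j.
Proof.
move=> m0; elim: j => //= j IH.
have j2 : 0 <= 2 * j%:R :> R by rewrite mulr_ge0.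
apply: divr_gt0; first by rewrite mulr_gt0// ltr_wpDl.
by rewrite ltr_wpDr// ltr0n.
Qed.

(** On the sphere of [E] the squared projection to [E] is [1], so that
    [isotropic_step] becomes a recurrence for the moments. *)
Lemma haar_moment j w : (0 < \dim E)%N -> w \in E ->
  \int[mu]_(x in X) dot x w ^+ (2 * j) =
  sphere_moment (\dim E) j * dot w w ^+ j.
Proof.
move=> dE.
have mu1 : mu X = 1%E by case: hmu.
have bz := bmeas_sphere_entry; have b1 : bmeas X (cst (1 : R)) by exact: bmeas_cst.
have [A iso] := isotropic_exists mX bz b1 dE haar_isotropic.
have {}iso i v : v \in E ->
    \int[mu]_(x in X) dot x v ^+ (2 * i) = A i * dot v v ^+ i.
  by move=> vE; rewrite -iso//; apply: EX_eq => x _; rewrite mul1r.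
have iso1 i : isotropic mu X id (cst 1) E i (A i).
  by move=> v vE; rewrite -iso//; apply: EX_eq => x _; rewrite mul1r.
have uE := memv_pick E; set u := vpick E in uE.
have uu : dot u u != 0 by rewrite dot_eq0 vpick0 -dimv_eq0 -lt0n.
suff AE i : A i = sphere_moment (\dim E) i by move=> wE; rewrite iso// AE.
elim: i => [|i IH] /=.
  have := iso 0%N u uE; rewrite expr0 mulr1 => <-.
  rewrite -[RHS](EX_cst mX 1 mu1); apply: EX_eq => x _.
  by rewrite muln0 expr0.
have d0 : (\dim E)%:R + 2 * i%:R != 0 :> R.
  by rewrite gt_eqF// ltr_wpDr ?mulr_ge0// ltr0n.
apply: (canRL (mulfK d0)); apply: (mulIf (expf_neq0 i uu)).
rewrite -(isotropic_step mX bz b1 (iso1 i.+1) uE) -IH mulrAC -iso// mulrC.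
congr (_ * _); apply: EX_eq => x [sx xE].
by rewrite /sqproj proj_id//= (sx : dot x x = 1) mul1r mulr1.
Qed.

End sphere_integrals.

Section radon_poly.
Variables (R : realType) (n : nat) (e : 'rV[R]_n).

Definition sqlen (E : {vspace 'rV[R]_n}) : R := dot (proj E e) (proj E e).

Lemma sqlen_ge0 E : 0 <= sqlen E. Proof. exact: dot_ge0. Qed.

Lemma sqlen_le1 E : dot e e = 1 -> sqlen E <= 1.
Proof. by move=> <-; exact: dot_proj_le. Qed.

(** The Radon transform multiplies the monomials in [<x, e> ^+ 2] by the moments
    of the sphere, which are divided out beforehand. *)
Definition radon_primitive m (p : {poly R}) (x : 'rV[R]_n) : R :=
  \sum_(j < size p) p`_j / sphere_moment R m j * dot x e ^+ (2 * j).

Lemma contS_radon_primitive m p : contS n (radon_primitive m p).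
Proof.
apply: continuous_subspaceT; apply: continuous_sumr => j.
have c : continuous (fun x : 'rV[R]_n => dot x e).
  by apply: continuous_dot; [move=> x; exact: cvg_id|exact: cst_continuous].
have cX i : continuous (fun x : 'rV[R]_n => dot x e ^+ i).
  elim: i => [|i IH]; first by under eq_fun do rewrite expr0; exact: cst_continuous.
  by under eq_fun do rewrite exprS; move=> x; exact: (cvgM (c x) (IH x)).
by move=> x; exact: (cvgM (cvg_cst _) (cX (2 * j)%N x)).
Qed.

Lemma radon_radon_primitive m (p : {poly R}) (E : grassmann R n m) :
  (0 < m)%N -> radon (radon_primitive m p) E = p.[sqlen E].
Proof.
move=> m0; have dE : \dim E = m by case: E => E /= /eqP.
have dE0 : (0 < \dim E)%N by rewrite dE.
have hmu := sphere_measureP dE0.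
have mX := measurable_sphereI E.
have bz := bmeas_sphere_entry E.
rewrite /radon /radon_primitive EX_sum//; last first.
  by move=> j; apply: bmeasZ; apply: bmeasX; apply: (bmeas_dot bz).
rewrite horner_coef; apply: eq_bigr => j _.
rewrite EX_Z//; last by apply: bmeasX; exact: (bmeas_dot bz).
have -> : \int[sphere_measure E]_(x in sphere n `&` [set` gr_space E])
    dot x e ^+ (2 * j) = sphere_moment R m j * sqlen E ^+ j.
  have := haar_moment hmu j dE0 (memv_eproj E e).
  rewrite [X in sphere_moment R X j]dE => <-.
  by apply: EX_eq => x [_ xE]; rewrite -dot_proj_sym proj_id.
by rewrite mulrA divfK// gt_eqF// sphere_moment_gt0.
Qed.

Lemma radon_image_ge0_poly m (p : {poly R}) : (0 < m)%N -> dot e e = 1 ->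
  (forall c, 0 <= c <= 1 -> 0 <= p.[c]) ->
  radon_image_ge0 n m (fun E : grassmann R n m => p.[sqlen E]).
Proof.
move=> m0 ee p0; split; last by move=> E; rewrite p0// sqlen_ge0 sqlen_le1.
exists (radon_primitive m p); first exact: contS_radon_primitive.
by apply/funext => E; exact: radon_radon_primitive.
Qed.

End radon_poly.

(** * Smoothness *)

Section regular.
Variables (R : realType) (p q : nat) (U : set 'M[R]_(p, q)).
Hypothesis oU : open U.

(** The rational functions of the entries of a matrix that are defined on [U].
    This class of functions is stable under directional derivatives. *)
Inductive regular : ('M[R]_(p, q) -> R) -> Prop :=
| regular_cst c : regular (cst c)
| regular_entry i j : regular (fun A => A i j)
| regularD f g : regular f -> regular g -> regular (fun A => f A + g A)
| regularM f g : regular f -> regular g -> regular (fun A => f A * g A)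
| regularV f : regular f -> (forall A, U A -> f A != 0) ->
    regular (fun A => (f A)^-1)
| regular_ext f g : regular f -> (forall A, U A -> f A = g A) -> regular g.

Let near_ext (f g : 'M[R]_(p, q) -> R) A : U A -> (forall B, U B -> f B = g B) ->
  \forall B \near A, f B = g B.
Proof.
move=> UA fg; have nU : nbhs A U by exact: open_nbhs_nbhs.
by apply: filterS nU.
Qed.

Lemma regular_continuous f A : regular f -> U A -> {for A, continuous f}.
Proof.
move=> rf; elim: rf A => {f} [c|i j|f g _ IHf _ IHg|f g _ IHf _ IHg|f _ IHf f0|f g _ IHf fg] A UA.
- exact: cst_continuous.
- exact: continuous_entry.
- exact: (cvgD (IHf A UA) (IHg A UA)).
- exact: (cvgM (IHf A UA) (IHg A UA)).
- exact: (cvgV (f0 A UA) (IHf A UA)).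
- suff : g @ A --> g A by [].
  rewrite -(fg A UA); apply: cvg_trans (IHf A UA).
  exact: (near_eq_cvg (near_ext UA fg)).
Qed.

Lemma regular_derive f : regular f ->
  (forall A v, U A -> derivable (f : _ -> R^o) A v) /\
  (forall v, regular (fun A => 'D_v (f : _ -> R^o) A)).
Proof.
elim=> {f} [c|i j|f g rf [df rdf] rg [dg rdg]|f g rf [df rdf] rg [dg rdg]
  |f rf [df rdf] f0|f g rf [df rdf] fg].
- split=> [A v _|v]; first exact: derivable_cst.
  apply: regular_ext (regular_cst 0) _ => A UA.
  by rewrite (derive_cst (c : R^o)).
- have dij A : differentiable ((fun B : 'M[R]_(p, q) => B i j) : _ -> R^o) A.
    exact: differentiable_coord.
  split=> [A v _|v]; first exact: diff_derivable.
  apply: regular_ext (regular_cst (v i j)) _ => A UA.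
  rewrite deriveE//.
  have lin : linear ((fun B : 'M[R]_(p, q) => B i j) : _ -> R^o).
    by move=> a B C; rewrite !mxE.
  pose L := GRing.isLinear.Build _ _ _ _ _ lin.
  pose F : {linear 'M[R]_(p, q) -> R^o} := HB.pack (fun B : 'M[R]_(p, q) => B i j : R^o) L.
  rewrite -[X in 'd X A]/(F : _ -> _) diff_lin//.
  exact: continuous_entry.
- split=> [A v UA|v]; first exact: (derivableD (df A v UA) (dg A v UA)).
  apply: regular_ext (regularD (rdf v) (rdg v)) _ => A UA.
  by rewrite -(deriveD (df A v UA) (dg A v UA)).
- split=> [A v UA|v]; first exact: (derivableM (df A v UA) (dg A v UA)).
  apply: regular_ext (regularD (regularM rf (rdg v)) (regularM rg (rdf v))) _ => A UA.
  by rewrite -(deriveM (df A v UA) (dg A v UA)).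
- split=> [A v UA|v]; first exact: (derivableV (f0 A UA) (df A v UA)).
  have rV := regularV rf f0.
  apply: regular_ext (regularM (regularM (regular_cst (- 1)) (regularM rV rV)) (rdf v)) _ => A UA.
  by rewrite (deriveV (f0 A UA) (df A v UA)) /GRing.scale /= mulN1r expr2 invfM.
- split=> [A v UA|v].
    apply: (@near_eq_derivable _ _ _ (f : _ -> R^o)); last exact: df.
    exact: near_ext.
  apply: regular_ext (rdf v) _ => A UA.
  by apply: near_eq_derive; exact: near_ext.
Qed.

Lemma regular_smooth f : regular f -> smooth_on U f.
Proof.
move=> rf s A UA /=.
have rg : regular (foldr (fun v (h : 'M[R]_(p, q) -> R^o) B => 'D_v h B) f s).
  by elim: s => //= v s IH; have [_] := regular_derive IH; apply.
split; first exact: regular_continuous.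
by move=> v; have [+ _] := regular_derive rg; apply.
Qed.

Lemma regular_sum (I : Type) (r : seq I) (P : pred I) (f : I -> 'M[R]_(p, q) -> R) :
  (forall i, regular (f i)) -> regular (fun A => \sum_(i <- r | P i) f i A).
Proof.
move=> hf; elim: r => [|i r IH].
  by under eq_fun do rewrite big_nil; exact: regular_cst.
under eq_fun do rewrite big_cons; case: (P i) => //.
exact: regularD.
Qed.

Lemma regular_prod (I : Type) (r : seq I) (P : pred I) (f : I -> 'M[R]_(p, q) -> R) :
  (forall i, regular (f i)) -> regular (fun A => \prod_(i <- r | P i) f i A).
Proof.
move=> hf; elim: r => [|i r IH].
  by under eq_fun do rewrite big_nil; exact: regular_cst.
under eq_fun do rewrite big_cons; case: (P i) => //.
exact: regularM.
Qed.

Definition regular_mx m n (F : 'M[R]_(p, q) -> 'M[R]_(m, n)) :=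
  forall i j, regular (fun A => F A i j).

Lemma regular_mulmx m n l (F : 'M[R]_(p, q) -> 'M[R]_(m, n)) (G : _ -> 'M[R]_(n, l)) :
  regular_mx F -> regular_mx G -> regular_mx (fun A => F A *m G A).
Proof.
move=> rF rG i j; under eq_fun do rewrite mxE.
by apply: regular_sum => k; exact: regularM.
Qed.

Lemma regular_tr m n (F : 'M[R]_(p, q) -> 'M[R]_(m, n)) :
  regular_mx F -> regular_mx (fun A => (F A)^T).
Proof. by move=> rF i j; under eq_fun do rewrite mxE. Qed.

Lemma regular_det m (F : 'M[R]_(p, q) -> 'M[R]_m) :
  regular_mx F -> regular (fun A => \det (F A)).
Proof.
move=> rF; apply: regular_sum => s; apply: regularM; first exact: regular_cst.
exact: regular_prod.
Qed.

Lemma regular_invmx m (F : 'M[R]_(p, q) -> 'M[R]_m) :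
  regular_mx F -> (forall A, U A -> F A \in unitmx) ->
  regular_mx (fun A => invmx (F A)).
Proof.
move=> rF uF i j.
apply: (@regular_ext (fun A => (\det (F A))^-1 * \adj (F A) i j)).
  apply: regularM.
    apply: regularV; first exact: regular_det.
    by move=> A /uF; rewrite unitmxE unitfE.
  under eq_fun do rewrite mxE /cofactor.
  apply: regularM; first exact: regular_cst.
  apply: regular_det => k l; under eq_fun do rewrite !mxE.
  exact: rF.
by move=> A UA; rewrite /invmx uF// [RHS]mxE.
Qed.

Lemma regular_horner (P : {poly R}) f :
  regular f -> regular (fun A => P.[f A]).
Proof.
move=> rf; under eq_fun do rewrite horner_coef.
apply: regular_sum => i; apply: regularM; first exact: regular_cst.
elim: (nat_of_ord i) => [|k IH].
  by under eq_fun do rewrite expr0; exact: regular_cst.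
by under eq_fun do rewrite exprS; exact: regularM.
Qed.

End regular.

Section frames.
Variables (R : realType) (n m : nat).
Implicit Types (A : 'M[R]_(m, n)) (e : 'rV[R]_n).

Lemma row_free_gram A : row_free A = (A *m A^T \in unitmx).
Proof.
apply/idP/idP => [Af|AA].
  rewrite -row_free_unit; apply/inj_row_free => v vAA.
  apply: (row_free_inj Af); rewrite mul0mx; apply/eqP; rewrite -dot_eq0.
  by rewrite dotE trmx_mul mulmxA -(mulmxA v) vAA mul0mx mxE.
apply/inj_row_free => v vA.
by rewrite -row_free_unit in AA; apply: (row_free_inj AA); rewrite mulmxA vA !mul0mx.
Qed.

Lemma open_row_free : open [set A : 'M[R]_(m, n) | row_free A].
Proof.
have /continuousP c : continuous (fun A : 'M[R]_(m, n) => \det (A *m A^T)).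
  move=> A; apply: (@regular_continuous _ _ _ setT openT) => //.
  apply: regular_det; apply: regular_mulmx; last apply: regular_tr;
    move=> i j; exact: regular_entry.
have -> : [set A : 'M[R]_(m, n) | row_free A] =
    (fun A : 'M[R]_(m, n) => \det (A *m A^T)) @^-1` (~` [set 0]).
  apply/seteqP; split => A /=; rewrite row_free_gram unitmxE unitfE.
    by move/eqP.
  by move=> h; apply/eqP.
by apply: c; apply: closed_openC; exact: closed_eq.
Qed.

Lemma row_spanE A : row_span A = (linfun (mulmxr A) @: fullv)%VS.
Proof.
apply/eqP; rewrite eqEsubv; apply/andP; split.
  apply/span_subvP => _ /mapP[i _ ->]; rewrite rowE.
  by apply/memv_imgP; exists (delta_mx 0 i); rewrite ?memvf// lfunE.
apply/subvP => _ /memv_imgP[y _ ->]; rewrite lfunE /= mulmx_sum_row.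
apply: rpred_sum => i _; apply: rpredZ.
by apply: memv_span; apply: map_f; rewrite mem_enum.
Qed.

Lemma mem_row_span A x :
  reflect (exists y : 'rV[R]_m, x = y *m A) (x \in row_span A).
Proof.
rewrite row_spanE; apply: (iffP memv_imgP) => [[y _]|[y]] ->; exists y;
  by rewrite ?memvf ?lfunE.
Qed.

Lemma dim_row_span A : row_free A -> \dim (row_span A) = m.
Proof.
move=> Af; rewrite row_spanE limg_dim_eq ?dimvf /dim /= ?mul1n//.
apply/eqP; rewrite -subv0; apply/subvP => y; rewrite memv_cap memv_ker lfunE /=.
rewrite memv0 => /andP[_ /eqP yA]; apply/eqP; apply: (row_free_inj Af).
by rewrite yA mul0mx.
Qed.

Lemma proj_row_span A e : row_free A ->
  proj (row_span A) e = e *m A^T *m invmx (A *m A^T) *m A.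
Proof.
rewrite row_free_gram => uA; apply: projP.
  by apply/mem_row_span; eexists.
move=> _ /mem_row_span[y ->]; rewrite !dotE trmx_mul !mulmxA.
by rewrite -(mulmxA _ A) mulmxKV.
Qed.

(** On the frames [A], [sqlen e] is [e A^T (A A^T)^-1 A e^T]. *)
Lemma smoothG_poly_sqlen (p : {poly R}) e :
  smoothG (fun E : grassmann R n m => p.[sqlen e E]).
Proof.
apply: regular_smooth; first exact: open_row_free.
set U := [set A | _].
have rA : regular_mx U (fun A : 'M[R]_(m, n) => A) by move=> i j; exact: regular_entry.
have rc k l (C : 'M[R]_(k, l)) : regular_mx U (fun _ : 'M[R]_(m, n) => C).
  by move=> i j; exact: regular_cst.
have rT := regular_tr rA.
have rS : regular_mx U (fun A : 'M[R]_(m, n) =>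
    e *m A^T *m invmx (A *m A^T) *m A *m e^T).
  do ?[apply: regular_mulmx] => //; apply: regular_invmx; first exact: regular_mulmx.
  by move=> A; rewrite -row_free_gram.
apply: regular_ext (regular_horner p (rS 0 0)) _ => A UA.
rewrite /frame_pullback insubT; first by rewrite dim_row_span.
by move=> dA /=; rewrite /sqlen -dot_projK -dotE -proj_row_span//.
Qed.

End frames.

(** * Averages of Radon transforms over the orthogonal group *)

Section sphere_functions.
Variables (R : realType) (n : nat).

Lemma closed_sphere : closed (sphere n : set 'rV[R]_n).
Proof.
have /continuous_closedP c : continuous (fun x : 'rV[R]_n => dot x x).
  by apply: continuous_dot => x; exact: cvg_id.
by apply: (c [set 1]); exact: closed_eq.
Qed.

Lemma compact_sphere : compact (sphere n : set 'rV[R]_n).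
Proof.
apply: bounded_closed_compact; last exact: closed_sphere.
exists 1; split; first exact: num_real.
move=> r r1 x sx; apply: le_trans (ltW r1).
rewrite /Num.norm /= mx_normrE; apply/bigmax_leP; split => // -[i j] _ /=.
by rewrite (ord1 i); exact: sphere_entry_le1.
Qed.

Lemma contS_bmeas (g : 'rV[R]_n -> R) : contS n g ->
  bmeas (sphere n : set (borel_rV R n)) (g : borel_rV R n -> R).
Proof.
move=> cg; split.
  apply: (measurability _ (RGenOpens.measurableE R)).
  move=> _ [_ [a [b ->] <-]].
  have oI : open (`]a, b[%classic : set R) by exact: interval_open.
  have /continuousP cg' := cg.
  have oS := cg' _ oI.
  move/open_subspaceP : oS => [V oV VE].
  rewrite setIC -VE; apply: measurableI; last exact: measurable_sphere.
  exact: open_borel_mx.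
have := compact_bounded (continuous_compact cg compact_sphere).
move=> [C [_ h]]; exists (C + 1) => x sx.
by apply: (h (C + 1)); [rewrite ltrDl|exists x].
Qed.

Lemma bmeas_sub d (T : measurableType d) (D D' : set T) (f : T -> R) :
  measurable D' -> D `<=` D' -> bmeas D' f -> bmeas D f.
Proof.
move=> mD' DD' [mf [C hC]]; split; first exact: measurable_funS mf.
by exists C => x /DD'; exact: hC.
Qed.

Lemma contS_bmeas_orth (g : 'rV[R]_n -> R) (Q : 'M[R]_n) :
  contS n g -> Q *m Q^T = 1%:M ->
  bmeas (sphere n : set (borel_rV R n)) (fun x : borel_rV R n => g (x *m Q)).
Proof.
move=> cg QQ; have mQ := @measurable_mulmxr R n n Q.
apply: bmeas_sub (bmeas_comp mQ (@measurable_sphere R n) (contS_bmeas cg)).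
  by rewrite -[X in measurable X]setTI; apply: mQ => //; exact: measurable_sphere.
by move=> x sx; rewrite /sphere /= dot_orth.
Qed.

Lemma haar_img (E : {vspace 'rV[R]_n}) (mu : probability (borel_rV R n) R)
    (Q : 'M[R]_n) : Q *m Q^T = 1%:M -> haar_sphere E mu ->
  haar_sphere (img Q E) (push mu (@measurable_mulmxr R n n Q)).
Proof.
move=> QQ [mu1 inv]; split.
  rewrite -mu1 /push /= /pushforward; congr (mu _).
  apply/seteqP; split => x; rewrite /sphere /= dot_orth// => -[sx xE]; split => //.
    by move: xE => /mem_img_mxP[y yE /(orth_inj QQ) ->].
  exact: memv_img_mx.
move=> Q' QQ' QE A mA; rewrite /push /= /pushforward.
have mQA : measurable ((fun x : borel_rV R n => x *m Q : borel_rV R n) @^-1` A).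
  by rewrite -[X in measurable X]setTI; exact: measurable_mulmxr.
rewrite -[RHS](inv (Q *m Q' *m Q^T))//.
- congr (mu _); apply/seteqP; split => x /=;
  by rewrite !mulmxA -(mulmxA _ Q^T) (mulmx1C QQ) mulmx1.
- by apply: orthM; [exact: orthM|exact: orth_tr].
move=> x xE; have /mem_img_mxP[y yE yQ] := QE _ (memv_img_mx Q xE).
by rewrite !mulmxA yQ -mulmxA QQ mulmx1.
Qed.

(** The Radon transform on bare subspaces, so that rotating a subspace requires
    no transport of its dimension. *)
Definition radonv (g : 'rV[R]_n -> R) (E : {vspace 'rV[R]_n}) : R :=
  \int[sphere_measure E]_(x in sphere n `&` [set` E]) g x.

(** This is where the uniqueness of the invariant measure is needed: it
    identifies the measure chosen on the sphere of [img Q E] with the image of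
    the one chosen on the sphere of [E]. *)
Lemma radonv_img g (E : {vspace 'rV[R]_n}) (Q : 'M[R]_n) :
  contS n g -> (0 < \dim E)%N -> Q *m Q^T = 1%:M ->
  radonv g (img Q E) =
  \int[sphere_measure E]_(x in sphere n `&` [set` E]) g (x *m Q).
Proof.
move=> cg dE QQ; have dQE : (0 < \dim (img Q E))%N by rewrite dim_img.
rewrite /radonv -(@EX_push _ _ _ _ _ (sphere_measure E)
  (sphere_measure (img Q E)) (fun x => x *m Q)); last first.
- apply: bmeas_sub (contS_bmeas cg); first exact: measurable_sphere.
  by move=> x [].
- exact: measurable_sphereI.
- move=> A mA; rewrite -(haar_sphere_unique (haar_img QQ (sphere_measureP dE))
    (sphere_measureP dQE) mA).
  by [].
- exact: measurable_mulmxr.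
suff -> : (fun x : 'rV[R]_n => x *m Q) @^-1` (sphere n `&` [set` img Q E]) =
  sphere n `&` [set` E] by [].
apply/seteqP; split => x; rewrite /sphere /= dot_orth// => -[sx xE]; split => //.
  by move: xE => /mem_img_mxP[y yE /(orth_inj QQ) ->].
exact: memv_img_mx.
Qed.

End sphere_functions.

Section orthogonal_average.
Variables (R : realType) (n : nat) (e : 'rV[R]_n).
Variable nu : probability (borel_mx R n n) R.
Hypotheses (ee : dot e e = 1) (hnu : haar_orth nu).

Let O : set (borel_mx R n n) := orthogonal n.
Let z (M : borel_mx R n n) : 'rV[R]_n := e *m M.

Let mO : measurable O. Proof. exact: measurable_orthogonal. Qed.

Lemma measurable_mul_e :
  measurable_fun setT ((fun M => e *m M) : borel_mx R n n -> borel_rV R n).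
Proof. exact: measurable_fun_mulmx. Qed.

Lemma mul_e_sphere M : O M -> sphere n (e *m M).
Proof. by move=> MM; rewrite /sphere /= dot_orth. Qed.

Lemma bmeas_mul_e i : bmeas O (fun M => z M 0 i).
Proof.
split; last by exists 1 => M MM; exact/sphere_entry_le1/mul_e_sphere.
apply: measurable_funTS; apply: (measurableT_comp (@measurable_entry R 1 n 0 i)).
exact: measurable_mul_e.
Qed.

Lemma haar_orth_integral (Q : 'M[R]_n) (f : borel_mx R n n -> R) :
  Q *m Q^T = 1%:M -> bmeas O f ->
  \int[nu]_(M in O) f (M *m Q) = \int[nu]_(M in O) f M.
Proof.
move=> QQ bf.
rewrite -[RHS](@EX_push _ _ _ _ _ nu nu (fun M => M *m Q) O f)//; last 2 first.
- exact: measurable_mulmx_cst.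
- by case: hnu => _ inv A mA; exact: inv.
suff -> : (fun M : 'M[R]_n => M *m Q) @^-1` O = O by [].
by apply/seteqP; split => M; rewrite /O /orthogonal /= trmx_mul mulmxA -(mulmxA M) QQ mulmx1.
Qed.

Let bG g (x : 'rV[R]_n) : contS n g -> sphere n x ->
  bmeas O (fun M : borel_mx R n n => g (x *m M^T)).
Proof.
move=> cg sx; have mx : measurable_fun setT
    ((fun M => x *m M^T) : borel_mx R n n -> borel_rV R n).
  by apply: measurable_fun_mulmx => //; exact: measurable_fun_tr.
apply: bmeas_sub (bmeas_comp mx (@measurable_sphere R n) (contS_bmeas cg)).
  rewrite -[X in measurable X]setTI; apply: mx => //.
  exact: measurable_sphere.
by move=> M MM; rewrite /sphere /= dot_orth//; exact: orth_tr.
Qed.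

(** Multiplying [M] on the right by a rotation fixing [x] does not change
    [x *m M^T] and rotates [e *m M].  Hence, conditionally on the point
    [x *m M^T], the vector [e *m M] is isotropic in the complement of [x], and
    [sqproj_spread] applies to the subspace [perp W] of this complement. *)
Lemma average_spread g (x : 'rV[R]_n) (W : {vspace 'rV[R]_n}) (eta : R) :
  contS_ge0 n g -> sphere n x -> x \in W -> (0 < \dim (perp W))%N ->
  eta <= (2^-1) ^+ 2 * (2 * (n.-1%:R - (\dim (perp W))%:R) /
    (n.-1%:R * ((\dim (perp W))%:R + 2))) ->
  0 <= \int[nu]_(M in O) (g (x *m M^T) * ((sqproj z (perp W) M - 2^-1) ^+ 2 - eta)).
Proof.
move=> [cg g0] sx xW dU; set k := _ * _ => ek; have bz := bmeas_mul_e.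
have G0 M : O M -> 0 <= g (x *m M^T).
  by move=> MM; apply: g0; rewrite /sphere /= dot_orth//; exact: orth_tr.
have x0 : x != 0 by rewrite -dot_eq0 (sx : dot x x = 1) oner_eq0.
have dV : \dim (perp <[x]>%VS) = n.-1 by rewrite dim_perp dim_vline x0 subn1.
have UV : (perp W <= perp <[x]>)%VS.
  apply/subvP => y /mem_perpP yW; apply/mem_perpP => _ /vlineP[a ->].
  by apply: yW; rewrite rpredZ.
have bGx := bG cg sx.
have inv w w' j : w \in perp <[x]>%VS -> w' \in perp <[x]>%VS -> dot w w = dot w' w' ->
    \int[nu]_(M in O) (g (x *m M^T) * dot (z M) w ^+ j) =
    \int[nu]_(M in O) (g (x *m M^T) * dot (z M) w' ^+ j).
  move=> /mem_perpP wx /mem_perpP w'x ww'.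
  rewrite -(@haar_orth_integral (refl (w - w'))).
  - apply: EX_eq => M _; rewrite trmx_mul refl_tr mulmxA refl_fix; last first.
      by rewrite dotC dotBl wx ?w'x ?memv_line// subrr.
    by rewrite /z mulmxA dot_mulmx refl_tr refl_swap.
  - exact: refl_orth.
  - by apply: bmeasM => //; apply: bmeasX; exact: bmeas_dot.
have := sqproj_spread mO bz bGx 2^-1 UV dU inv G0.
rewrite dV -/k => /le_trans; apply.
have bs : bmeas O (fun M => (sqproj z (perp W) M - 2^-1) ^+ 2).
  by apply: bmeasX; apply: bmeasB; [exact: bmeas_sqproj|exact: bmeas_cst].
apply: EX_le => //.
- by apply: bmeasM => //; apply: bmeasB => //; exact: bmeas_cst.
- by apply: bmeasM => //; apply: bmeasB => //; exact: bmeas_cst.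
by move=> M MM; rewrite ler_wpM2l ?G0// lerB.
Qed.

Lemma sqproj_sqlen (W : {vspace 'rV[R]_n}) M : O M ->
  sqproj z W M = sqlen e (img M^T W).
Proof.
move=> MM; have MT := orth_tr MM.
have -> : sqlen e (img M^T W) = sqlen (e *m M *m M^T) (img M^T W).
  by rewrite -mulmxA MM mulmx1.
by rewrite /sqlen proj_img// dot_orth.
Qed.

Let bpair (g : 'rV[R]_n -> R) (W : {vspace 'rV[R]_n}) : contS n g ->
  bmeas (O `*` (sphere n `&` [set` W] : set (borel_rV R n)))
    (fun p : borel_mx R n n * borel_rV R n => g (p.2 *m p.1^T)).
Proof.
move=> cg; have mp : measurable_fun setT
    ((fun p => p.2 *m p.1^T) : borel_mx R n n * borel_rV R n -> borel_rV R n).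
  apply: measurable_fun_mulmx; first exact: measurable_snd.
  by apply: measurable_fun_tr; exact: measurable_fst.
apply: bmeas_sub (bmeas_comp mp (@measurable_sphere R n) (contS_bmeas cg)).
  rewrite -[X in measurable X]setTI; apply: mp => //.
  exact: measurable_sphere.
move=> [M x] [/= MM [sx _]]; rewrite /sphere /= dot_orth//; exact: orth_tr.
Qed.

Lemma bmeas_radonv_img g (W : {vspace 'rV[R]_n}) : contS n g -> (0 < \dim W)%N ->
  bmeas O (fun M : borel_mx R n n => radonv g (img M^T W)).
Proof.
move=> cg dW; have [mf [C hC]] := bmeas_EX nu (sphere_measure W) mO
  (measurable_sphereI W) (bpair W cg).
have h M : O M -> radonv g (img M^T W) =
    \int[sphere_measure W]_(x in sphere n `&` [set` W]) g (x *m M^T).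
  by move=> MM; rewrite radonv_img//; exact: orth_tr.
split; last by exists C => M MM; rewrite h//; exact: hC.
by apply: eq_measurable_fun mf => M /[!inE] MM; rewrite h.
Qed.

(** The Radon transform at [img M^T W] averages [g (x *m M^T)] over the fixed
    sphere of [W].  By Fubini the average over [M] can be taken first, for a
    given [x], where it is nonnegative by [average_spread]. *)
Lemma average_radonv_ge0 g (W : {vspace 'rV[R]_n}) (eta : R) :
  contS_ge0 n g -> (0 < \dim W)%N -> (0 < \dim (perp W))%N ->
  eta <= (2^-1) ^+ 2 * (2 * (n.-1%:R - (\dim (perp W))%:R) /
    (n.-1%:R * ((\dim (perp W))%:R + 2))) ->
  0 <= \int[nu]_(M in O) (((sqproj z (perp W) M - 2^-1) ^+ 2 - eta) *
    radonv g (img M^T W)).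
Proof.
move=> g0 dW dU ek; have [cg _] := g0; have bz := bmeas_mul_e.
pose X : set (borel_rV R n) := sphere n `&` [set` W].
have mX : measurable X by exact: measurable_sphereI.
pose p (M : borel_mx R n n) := (sqproj z (perp W) M - 2^-1) ^+ 2 - eta.
have bp : bmeas O p.
  apply: bmeasB; last exact: bmeas_cst.
  by apply: bmeasX; apply: bmeasB; [exact: bmeas_sqproj|exact: bmeas_cst].
have bf : bmeas (O `*` X) (fun q : borel_mx R n n * borel_rV R n =>
    p q.1 * g (q.2 *m q.1^T)).
  apply: bmeasM; last exact: bpair.
  have [mp [C hC]] := bp; split; last by exists C => -[M x] [MM _]; exact: hC.
  apply: (measurable_comp mO) => //; first by move=> _ [[M x] [MM _] <-].
  by apply: measurable_funTS; exact: measurable_fst.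
rewrite (_ : Rintegral _ _ _ = \int[nu]_(M in O)
    \int[sphere_measure W]_(x in X) (p M * g (x *m M^T))); last first.
  apply: EX_eq => M MM; rewrite radonv_img//; last exact: orth_tr.
  rewrite -EX_Z//; apply: (@bmeas_sub _ _ _ X (sphere n)).
  - exact: measurable_sphere.
  - by move=> x [].
  - exact/contS_bmeas_orth/orth_tr.
rewrite (EX_Fubini _ _ mO mX bf).
apply: Rintegral_ge0 => x [sx xW].
under eq_Rintegral do rewrite mulrC.
exact: average_spread.
Qed.

End orthogonal_average.

(** * Bumps concentrated where the test weight is negative *)

Section bump.
Variable R : realType.

Definition bump N : {poly R} := (1 - ('X - (2^-1)%:P) ^+ 2) ^+ N.

Lemma bumpE N c : (bump N).[c] = (1 - (c - 2^-1) ^+ 2) ^+ N.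
Proof. by rewrite /bump !(horner_exp, hornerE). Qed.

Lemma bump_ge0 N c : 0 <= c <= 1 -> 0 <= (bump N).[c].
Proof. by move=> /andP[c0 c1]; rewrite bumpE exprn_ge0//; nra. Qed.

Context d (T : measurableType d) (P : probability T R) (D : set T).
Hypothesis mD : measurable D.

(** As [N] grows, the mass of [(1 - w) ^+ N] concentrates where [w] is small. *)
Lemma bump_average_lt0 (w : T -> R) (eta : R) :
  bmeas D w -> (forall t, D t -> 0 <= w t <= 1) -> 0 < eta <= 1 ->
  (0 < P (D `&` [set t | (w t < eta / 2)%R]))%E ->
  exists N, \int[P]_(t in D) ((w t - eta) * (1 - w t) ^+ N) < 0.
Proof.
move=> bw w01 /andP[eta0 eta1] PB.
set B := D `&` _ in PB.
have mB : measurable B.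
  have [mw _] := bw; have := mw mD `]-oo, eta / 2[%classic (measurable_itv _).
  by [].
pose al := fine (P B).
have al0 : 0 < al.
  by rewrite fine_gt0// PB /= (le_lt_trans (probability_le1 _ _))// ltry.
pose q := (1 - eta) / (1 - eta / 2).
have q0 : 0 <= q by rewrite divr_ge0; lra.
have q1 : `|q| < 1 by rewrite ger0_norm// ltr_pdivrMr; lra.
have [N qN] : exists N, q ^+ N < al * (eta / 2).
  have := cvg_expr q1 => /cvgrPdist_lt /(_ (al * (eta / 2))).
  have ale : 0 < al * (eta / 2) by rewrite mulr_gt0// divr_gt0.
  move=> /(_ ale) [N _ h]; exists N.
  have := h N (leqnn N); rewrite sub0r normrN ger0_norm//.
  exact: exprn_ge0.
(* On [B] the integrand is at most [- be], and elsewhere it is at most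
   [(1 - eta) ^+ N], which is less than [al * be] by choice of [N]. *)
exists N.
have b1B : bmeas D (\1_B : T -> R).
  split; first exact: measurable_indic.
  by exists 1 => t _; rewrite indicE ger0_norm// lern1 leq_b1.
have E1B : \int[P]_(t in D) \1_B t = al.
  rewrite /Rintegral integral_indic// /al; congr (fine (P _)).
  by apply/setIidPl => t [].
pose be := (eta / 2) * (1 - eta / 2) ^+ N.
have PD1 : fine (P D) <= 1.
  have := probability_le1 P mD; rewrite -{1}(@fineK _ (P D)) ?lee_fin//.
  exact: fin_num_measure.
apply: (@le_lt_trans _ _ (\int[P]_(t in D) ((1 - eta) ^+ N - be * \1_B t))).
  apply: EX_le => //.
  - apply: bmeasM; first by apply: bmeasB => //; exact: bmeas_cst.
    by apply: bmeasX; apply: bmeasB => //; exact: bmeas_cst.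
  - by apply: bmeasB; [exact: bmeas_cst|exact: bmeasZ].
  move=> t Dt; have /andP[w0 w1] := w01 t Dt; rewrite indicE.
  have eN : 0 <= (1 - eta) ^+ N by rewrite exprn_ge0// subr_ge0.
  have [tB|tB] := boolP (t \in B); rewrite ?mulr1 ?mulr0 ?subr0.
    move: tB => /[!inE] -[_ /= wB].
    apply: (@le_trans _ _ (- be)); last by rewrite lerDr.
    rewrite /be -mulNr; apply: (@le_trans _ _ (- (eta / 2) * (1 - w t) ^+ N)).
      by rewrite ler_wpM2r ?exprn_ge0//; lra.
    rewrite !mulNr lerN2; apply: ler_wpM2l; first by lra.
    by apply: lerXn2r; rewrite ?nnegrE; lra.
  have [we|we] := leP (w t) eta.
    by rewrite (le_trans _ eN)// mulr_le0_ge0 ?exprn_ge0//; lra.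
  apply: (@le_trans _ _ (1 * (1 - w t) ^+ N)).
    by rewrite ler_wpM2r ?exprn_ge0//; lra.
  by rewrite mul1r; apply: lerXn2r; rewrite ?nnegrE; lra.
rewrite EX_B//; [|exact: bmeas_cst|exact: bmeasZ].
rewrite EX_Z// E1B Rintegral_cst// subr_lt0.
have p0 : 0 < (1 - eta / 2) ^+ N by rewrite exprn_gt0//; lra.
apply: (@le_lt_trans _ _ ((1 - eta) ^+ N)).
  by rewrite -[leRHS]mulr1 ler_wpM2l// exprn_ge0// subr_ge0.
move: qN; rewrite /q expr_div_n ltr_pdivrMr// => h; apply: lt_le_trans h _.
by rewrite /be; lra.
Qed.

End bump.

(** * Sums of Radon transforms do not approximate all bumps *)

Section non_approximation.
Variables (R : realType) (n : nat) (e : 'rV[R]_n).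
Hypothesis ee : dot e e = 1.
Variable E0 : {vspace 'rV[R]_n}.
Hypotheses (dE0 : (1 < \dim E0)%N) (dP0 : (1 < \dim (perp E0))%N).

Let dims : (\dim E0 + \dim (perp E0) = n)%N.
Proof.
rewrite dim_perp subnKC//; have := dimvS (subvf E0).
by rewrite dimvf /dim /= mul1n.
Qed.

(** The vector [e *m M] is uniform on the sphere.  The balls around the unit
    vector [z0], half of whose squared length is in [E0], have positive
    measure. *)
Let half_probability (nu : probability (borel_mx R n n) R) (r : R) :
  haar_orth nu -> 0 < r ->
  (0 < nu (orthogonal n `&` [set M : borel_mx R n n |
    ((sqproj (fun M : borel_mx R n n => e *m M) E0 M - 2^-1) ^+ 2 < r)%R])%classic)%E.
Proof.
move=> hnu r0.
have mO := @measurable_orthogonal R n.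
pose mu := push nu (measurable_mul_e e).
have hmu : haar_sphere fullv mu.
  split.
    apply/eqP; rewrite eq_le probability_le1 /=; last exact: measurable_sphereI.
    have [nu1 _] := hnu; rewrite -nu1; apply: le_measure; rewrite ?inE//.
      rewrite -[X in measurable X]setTI; apply: measurable_mul_e => //.
      exact: measurable_sphereI.
    by move=> M MM; split; [exact: mul_e_sphere|exact: memvf].
  move=> Q QQ _ A mA; rewrite /mu /push /= /pushforward.
  have [_ inv] := hnu; rewrite -[RHS](inv Q QQ).
    by congr (nu _); apply/seteqP; split => M /=; rewrite mulmxA.
  by rewrite -[X in measurable X]setTI; exact: measurable_mul_e.
have [u [su uE]] := haar_sphere_neq0 (sphere_measureP (ltnW dE0)).
have [v [sv vP]] := haar_sphere_neq0 (sphere_measureP (ltnW dP0)).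
have uv : dot u v = 0 by rewrite dotC; move/mem_perpP : vP; apply.
pose s : R := Num.sqrt 2^-1.
have s2 : s ^+ 2 = 2^-1 by rewrite sqr_sqrtr// invr_ge0.
pose z0 := s *: u + s *: v.
have z0s : (sphere n `&` [set` fullv]) z0.
  split; last exact: memvf.
  rewrite /sphere /= /z0 dot_sqrD !(dotZl, dotZr) (su : dot u u = 1).
  by rewrite (sv : dot v v = 1) uv !mulr0 !mulr1 addr0 -expr2 s2; field.
pose c y := (dot (proj E0 y) (proj E0 y) - 2^-1) ^+ 2.
have c0 : c z0 = 0.
  rewrite /c (_ : proj E0 z0 = s *: u); last first.
    apply: projP; first by rewrite rpredZ.
    move=> w wE; rewrite /z0 dotDl !dotZl.
    by move/mem_perpP : vP => ->//; rewrite mulr0 addr0.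
  by rewrite dotZl dotZr (su : dot u u = 1) mulr1 -expr2 s2 subrr expr0n.
have cc : continuous c.
  have cd : continuous (fun y : 'rV[R]_n => dot (proj E0 y) (proj E0 y)).
    under eq_fun do rewrite -sum_dot_proj_basis.
    apply: continuous_sumr => i.
    have ci : continuous (fun y : 'rV[R]_n => dot y (proj E0 (basis_vec R i))).
      by apply: continuous_dot; [move=> y; exact: cvg_id|exact: cst_continuous].
    by move=> y; exact: (cvgM (ci y) (ci y)).
  move=> y.
  have cb : (fun y => dot (proj E0 y) (proj E0 y) - 2^-1) @ y -->
    dot (proj E0 y) (proj E0 y) - 2^-1 by exact: (cvgB (cd y) (cvg_cst _)).
  exact: (cvgM cb cb).
have oC : open [set y | c y < r].
  by move/continuousP : cc => /(_ _ (@open_lt _ r)).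
have [t t0 tC] : exists2 t, 0 < t & ball z0 t `<=` [set y | c y < r].
  have : nbhs z0 [set y | c y < r] by apply: open_nbhs_nbhs; split => //=; rewrite c0.
  by move=> /nbhs_ballP[t t0 h]; exists t.
have := haar_dball_gt0 hmu z0s (exprn_gt0 2 t0).
move/lt_le_trans; apply.
have mA : measurable ((fun M : borel_mx R n n => e *m M : borel_rV R n) @^-1` dball z0 (t ^+ 2)).
  rewrite -[X in measurable X]setTI; apply: measurable_mul_e => //.
  exact: measurable_dball.
have [nu1 _] := hnu.
have E1 := probability_full mA mO nu1.
rewrite [X in (X <= _)%E](esym E1 : _ = _) setIC.
apply: le_measure; rewrite ?inE.
- exact: measurableI.
- apply: measurableI => //.
  have -> : [set M : borel_mx R n n |
        (sqproj (fun M : borel_mx R n n => e *m M) E0 M - 2^-1) ^+ 2 < r] =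
      (fun M : borel_mx R n n => e *m M : borel_rV R n) @^-1` [set y | c y < r] by [].
  rewrite -[X in measurable X]setTI; apply: measurable_mul_e => //.
  exact: open_borel_mx.
by move=> M [MM h]; split => //; apply: tC; exact: sub_dball_ball h.
Qed.

(** Averaged over the orthogonal group against the weight [w - eta], the bump has
    a negative mean [I] for [N] large, whereas sums of Radon transforms of
    nonnegative functions have a nonnegative one.  As the weight is bounded by
    [1], they cannot be within [- I / 2] of each other everywhere. *)
Lemma bump_not_approximable : exists N, exists2 t : R, 0 < t &
  forall g h, contS_ge0 n g -> contS_ge0 n h ->
  exists2 Q : 'M[R]_n, Q *m Q^T = 1%:M & let E := img Q E0 in
    t <= `|(bump R N).[sqlen e E] - (radonv g E + radonv h (perp E))|.
Proof.
have [nu hnu] := haar_orth_exists R n.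
have mO := @measurable_orthogonal R n; have [nu1 _] := hnu.
pose z (M : borel_mx R n n) : 'rV[R]_n := e *m M.
pose O : set (borel_mx R n n) := orthogonal n.
have bz i : bmeas O (fun M => z M 0 i) := bmeas_mul_e ee i.
pose w M := (sqproj z E0 M - 2^-1) ^+ 2.
have bw : bmeas O w.
  by apply: bmeasX; apply: bmeasB; [exact: bmeas_sqproj|exact: bmeas_cst].
have zz M : O M -> dot (z M) (z M) = 1 by move=> MM; rewrite dot_orth.
have w01 M : O M -> 0 <= w M <= 1.
  move=> /zz MM; have := dot_proj_le E0 (z M); have := dot_ge0 (proj E0 (z M)).
  by rewrite MM /w /sqproj sqr_ge0 /= => h0 h1; nra.
(* the constants of [average_radonv_ge0]; they are positive because [E0] and its
   complement have codimension at least two *)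
pose ka r : R := (2^-1) ^+ 2 * (2 * (n.-1%:R - r%:R) / (n.-1%:R * (r%:R + 2))).
have ka0 r : (r < n.-1)%N -> 0 < ka r.
  move=> rn; have n0 : 0 < n.-1%:R :> R by rewrite ltr0n (leq_trans _ rn).
  have r2 : 0 < r%:R + 2 :> R by rewrite ltr_wpDl.
  rewrite /ka mulr_gt0 ?exprn_gt0// divr_gt0 ?mulr_gt0//.
  by rewrite subr_gt0 ltr_nat.
pose eta := Num.min 1 (Num.min (ka (\dim E0)) (ka (\dim (perp E0)))).
have eta0 : 0 < eta.
  have lt2 a b l : (a + b = l)%N -> (1 < b)%N -> (a < l.-1)%N.
    by move=> <-; case: b => [|[|b]] // _; rewrite !addnS /= ltnS leq_addr.
  have lE := lt2 _ _ _ dims dP0.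
  have lP := lt2 _ _ _ (etrans (addnC _ _) dims) dE0.
  by rewrite !lt_min ltr01 !ka0.
have eta1 : eta <= 1 by rewrite ge_min lexx.
have etaE : eta <= ka (\dim E0) by rewrite !ge_min lexx orbT.
have etaP : eta <= ka (\dim (perp E0)) by rewrite !ge_min lexx !orbT.
have [N neg] : exists N, \int[nu]_(M in O) ((w M - eta) * (1 - w M) ^+ N) < 0.
  apply: bump_average_lt0 => //; first by rewrite eta0 eta1.
  by apply: half_probability; rewrite ?divr_gt0.
set I := Rintegral _ _ _ in neg.
exists N; exists (- I / 2); first by rewrite divr_gt0// oppr_gt0.
move=> g h g0 h0; apply: contrapT => far; move: neg; apply/negP; rewrite -leNgt.
have [cg _] := g0; have [ch _] := h0.
pose S (M : borel_mx R n n) := radonv g (img M^T E0) + radonv h (img M^T (perp E0)).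
have bS : bmeas O S.
  by apply: bmeasD; apply: bmeas_radonv_img; rewrite // ltnW.
have bp : bmeas O (fun M => w M - eta) by apply: bmeasB => //; exact: bmeas_cst.
have bF : bmeas O (fun M => (1 - w M) ^+ N).
  by apply: bmeasX; apply: bmeasB => //; exact: bmeas_cst.
have close M : O M -> `|(1 - w M) ^+ N - S M| < - I / 2.
  move=> MM; rewrite ltNge; apply/negP => le; apply: far.
  exists M^T; first exact: orth_tr.
  by rewrite /= perp_img ?orth_tr// bumpE -sqproj_sqlen.
pose J := \int[nu]_(M in O) ((w M - eta) * S M).
pose K := \int[nu]_(M in O) ((w M - eta) * ((1 - w M) ^+ N - S M)).
have IS : 0 <= J.
  have -> : J =
      \int[nu]_(M in O) ((w M - eta) * radonv g (img M^T E0)) +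
      \int[nu]_(M in O) ((w M - eta) * radonv h (img M^T (perp E0))).
    rewrite /J -EX_D//.
    - by apply: EX_eq => M _; rewrite mulrDr.
    - by apply: bmeasM => //; apply: bmeas_radonv_img; rewrite // ltnW.
    - by apply: bmeasM => //; apply: bmeas_radonv_img; rewrite // ltnW.
  apply: addr_ge0.
    apply: le_trans (average_radonv_ge0 ee hnu g0 (ltnW dE0) (ltnW dP0) etaP) _.
    rewrite le_eqVlt; apply/orP; left; apply/eqP; apply: EX_eq => M MM.
    congr ((_ - _) * _); rewrite /w /sqproj.
    rewrite -[X in X - _](addrK (dot (proj E0 (z M)) (proj E0 (z M)))).
    by rewrite [_ + dot (proj E0 _) _]addrC dot_projD zz//; field.
  have := average_radonv_ge0 (W := perp E0) ee hnu h0 (ltnW dP0).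
  by rewrite perpK => /(_ eta (ltnW dE0) etaE).
have IE : I = K + J.
  rewrite /K /J -EX_D//; [|by apply: bmeasM => //; exact: bmeasB|exact: bmeasM].
  by apply: EX_eq => M _; ring.
have IK : - (- I / 2) <= K.
  rewrite -(EX_cst mO (- (- I / 2)) nu1); apply: EX_le => //.
  - exact: bmeas_cst.
  - by apply: bmeasM => //; exact: bmeasB.
  move=> M MM; have /andP[w0 w1] := w01 M MM; have := close M MM.
  set x := _ - S M; rewrite ltr_norml => /andP[x1 x2]; rewrite /=.
  by nra.
by clearbody I J K; lra.
Qed.

End non_approximation.

Lemma vspace_of_dim (R : realType) (n m : nat) : (m <= n)%N ->
  exists E : {vspace 'rV[R]_n}, \dim E = m.
Proof.
move=> mn; exists (row_span (pid_mx m : 'M[R]_(m, n))).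
by apply: dim_row_span; rewrite /row_free rank_pid_mx.
Qed.

Theorem theorem1p3 (R : realType) (n k : nat) (hn : (4 <= n)%N)
    (hk : (2 <= k <= n - 2)%N) :
  let hkn := leq_of_bounds hk in
  (@radon_image_ge0 R n (n - k) `\` closureCG (radon_cone hkn) !=set0) /\
  exists f : grassmann R n (n - k) -> R,
    [/\ smoothG f,
        radon_image_ge0 n (n - k) f &
        ~ (forall e : R, 0 < e -> exists g h : 'rV[R]_n -> R,
             [/\ contS_ge0 n g, contS_ge0 n h &
                 forall E, `|f E - (radon g E + comp_perp hkn (radon h) E)| < e])].
Proof.
move=> hkn; have /andP[k2 kn] := hk.
have m2 : (2 <= n - k)%N by rewrite leq_subRL// addnC -leq_subRL// (leq_trans _ hn).
have [E0 dE0] := @vspace_of_dim R n (n - k) (leq_subr _ _).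
have dP0 : \dim (perp E0) = k by rewrite dim_perp dE0 subKn.
pose e : 'rV[R]_n := basis_vec R (Ordinal (leq_trans (isT : 0 < 4)%N hn)).
have ee : dot e e = 1 by rewrite dot_basis mxE !eqxx.
have [N [t t0 far]] : exists N, exists2 t : R, 0 < t &
    forall g h, contS_ge0 n g -> contS_ge0 n h ->
    exists E : grassmann R n (n - k),
      t <= `|(bump R N).[sqlen e E] - (radon g E + comp_perp hkn (radon h) E)|.
  have [||N [t t0 far]] := @bump_not_approximable R n e ee E0.
  - by rewrite dE0.
  - by rewrite dP0.
  exists N, t => // g h g0 h0; have [Q QQ le] := far g h g0 h0.
  have dQ : \dim (img Q E0) == (n - k)%N by rewrite dim_img// dE0.
  by exists (Grassmann dQ).
pose f (E : grassmann R n (n - k)) : R := (bump R N).[sqlen e E].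
have fim : radon_image_ge0 n (n - k) f.
  by apply: radon_image_ge0_poly ee _; [exact: leq_trans m2|exact: bump_ge0].
have fS : smoothG f by exact: smoothG_poly_sqlen.
split; last first.
  exists f; split => // /(_ t t0)[g [h [g0 h0 close]]].
  by have [E] := far g h g0 h0; rewrite leNgt close.
exists f; split => // -[_ clf].
have nf : nbhs (f : {uniform grassmann R n (n - k) -> R})
    [set G | forall E, `|f E - G E| < t].
  apply/uniform_nbhs; exists [set xy | ball xy.1 t xy.2]; split.
    exact: entourage_ball (PosNum t0).
  by move=> G h E; exact: h.
have [G [[G1 [g g0 <-] [G2 [h h0 <-] <-]] close]] := clf _ nf.
have [E le] := far g h g0 h0.
by have := close E; rewrite /= ltNge le.
Qed.
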